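(* Fix $n\ge1$. For each $f\in W$ there exists a unique $u\in W$ satisfying $$ \begin{aligned} f(x) ={}& \chi_{A_n}(x)\int_{A_n} J(x,y)(u(y)-u(x))\,dy + \chi_{A_n}(x)\int_{B_n} R(x,y)(u(y)-u(x))\,dy\\ &+\chi_{B_n}(x)\int_{A_n} R(x,y)(u(y)-u(x))\,dy+\chi_{B_n}(x)\int_{B_n} G(x,y)(u(y)-u(x))\,dy,\qquad x\in\Omega, \end{aligned} $$ and this $u$ is the minimizer over $W$ of the functional $$ \begin{aligned} E_n(v)={}&\frac14\int_{A_n}\int_{A_n}J(x,y)(v(y)-v(x))^2\,dy\,dx+\frac14\int_{B_n}\int_{B_n}G(x,y)(v(y)-v(x))^2\,dy\,dx\\ &+\frac12\int_{A_n}\int_{B_n}R(x,y)(v(y)-v(x))^2\,dy\,dx+\int_\Omega f(x)v(x)\,dx . \end{aligned} $$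
   Context: $\Omega\subset\mathbb{R}^N$ is a bounded domain (open, connected). The kernels $V=J,G,R$ each satisfy: $V:\mathbb{R}^N\times\mathbb{R}^N\to\mathbb{R}$ is continuous and non-negative, $V(x,x)>0$ for every $x$, $V(x,y)=V(y,x)$ for all $x,y$, and $\int_{\mathbb{R}^N}V(x,y)\,dy=1$ for every $x$. $A_n,B_n$ are measurable sets with $\Omega=A_n\cup B_n$ and $A_n\cap B_n=\emptyset$; $\chi_E$ denotes the characteristic function of $E$. $W=\{u\in L^2(\Omega):\int_\Omega u\,dx=0\}$. The equation is understood for a.e. $x\in\Omega$. *)

(* Defs.v *)
From HB Require Import structures.
From mathcomp Require Import all_boot all_order all_algebra.
From mathcomp Require Import all_classical all_reals all_analysis.
From mathcomp Require Import measurable_realfun.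
Import Order.TTheory GRing.Theory Num.Theory numFieldNormedType.Exports.

Set Implicit Arguments.
Unset Strict Implicit.
Unset Printing Implicit Defensive.

Local Open Scope classical_set_scope.
Local Open Scope ring_scope.

Notation borel_rV R n := (g_sigma_algebraType (@open 'rV[R]_n)).

Section borel_measure.
Context {R : realType}.

Definition cons_rV (n : nat) (p : R * 'rV[R]_n) : 'rV[R]_n.+1 :=
  row_mx (const_mx p.1 : 'rV[R]_1) p.2.

(* n-fold product of the one-dimensional Lebesgue measure, by slicing along the
   first coordinate; the values on boxes are given in [borel_lebesgue_box]. *)
Fixpoint borel_lebesgue (n : nat) : set (borel_rV R n) -> \bar R :=
  if n is n'.+1 then
    fun A => (\int[@lebesgue_measure R]_x
                borel_lebesgue [set v : borel_rV R n' | A (cons_rV (x, v))])%E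
  else @dirac _ (borel_rV R 0) (0 : 'rV[R]_0) R.

Lemma cons_rV0 n (p : R * 'rV[R]_n) : cons_rV p ord0 ord0 = p.1.
Proof. by rewrite mxE; case: splitP => // j _; rewrite mxE. Qed.

Lemma cons_rVS n (p : R * 'rV[R]_n) i :
  cons_rV p ord0 (lift ord0 i) = p.2 ord0 i.
Proof.
rewrite mxE; case: splitP => [j /= ij|k /= ik]; first by have := ltn_ord j; rewrite -ij.
by congr (p.2 _ _); apply/val_inj; move: ik; rewrite /bump /= add1n => -[].
Qed.

Lemma rat_ball_rV n (v : 'rV[R]_n) (e : R) : 0 < e ->
  exists p : 'rV[rat]_n, ball v e (map_mx ratr p).
Proof.
move=> e0; have H i : exists q : rat, `|v ord0 i - ratr q| < e.
  have [] := @dense_rat R (ball (v ord0 i) e).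
  - by exists (v ord0 i); exact: ballxx.
  - exact: ball_open.
  - by move=> x [xe [q _ qx]]; exists q; rewrite qx.
have [f fP] := choice H.
exists (\row_i f i); split => // i j; rewrite !mxE ord1; exact: fP.
Qed.

Lemma open_borel n (U : set 'rV[R]_n) : open U -> measurable (U : set (borel_rV R n)).
Proof. exact: sub_sigma_algebra. Qed.

Lemma open_prod_measurable n (W : set (R * 'rV[R]_n)) : open W ->
  measurable (W : set (measurableTypeR R * borel_rV R n)).
Proof.
move=> oW.
pose B (t : rat * 'rV[rat]_n * nat) : set (R * 'rV[R]_n) :=
  ball (ratr t.1.1 : R) t.2.+1%:R^-1 `*`
  ball (map_mx ratr t.1.2 : 'rV[R]_n) t.2.+1%:R^-1.
have -> : W = \bigcup_t (if pselect (B t `<=` W) then B t else set0).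
  apply/seteqP; split=> [p Wp|p [t _]]; last by case: pselect => // BW /BW.
  have [e /= e0 eW] : exists2 e : R, 0 < e & ball p e `<=` W.
    by move/nbhs_ballP: (open_nbhs_nbhs (conj oW Wp)) => [e]; exists e.
  pose k := Num.truncn (2 / e).
  have ke : k.+1%:R^-1 < e / 2 :> R.
    rewrite -[ltRHS]invrK invf_div ltf_pV2 ?posrE ?divr_gt0//.
    by rewrite truncnS_gt.
  have k0 : 0 < k.+1%:R^-1 :> R by rewrite invr_gt0.
  have [] := @dense_rat R (ball p.1 k.+1%:R^-1).
  - by exists p.1; exact: ballxx.
  - exact: ball_open.
  - move=> x [bq [q _ qx]]; rewrite -{x}qx in bq.
    have [u bu] := rat_ball_rV p.2 k0.
    exists (q, u, k) => //; case: pselect => /= [_|].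
      by split => /=; exact: ball_sym.
    case=> y [/= y1 y2]; apply: eW; split.
      apply: (@le_ball _ _ _ (k.+1%:R^-1 + k.+1%:R^-1)).
        by rewrite [e]splitr lerD ?ltW.
      exact: ball_triangle bq y1.
    apply: (@le_ball _ _ _ (k.+1%:R^-1 + k.+1%:R^-1)).
      by rewrite [e]splitr lerD ?ltW.
    exact: ball_triangle bu y2.
apply: countable_bigcupT_measurable => [|t]; first exact: countableP.
case: pselect => /= [BW|_]; last exact: measurable0.
apply: measurableX.
  exact: measurable_ball.
apply: open_borel; exact: ball_open.
Qed.

Lemma cons_rV_continuous n : continuous (@cons_rV n).
Proof.
move=> p A /nbhs_ballP[e /= e0 eA]; apply/nbhs_ballP; exists e => //= q [q1 q2].
apply: eA; split=> // i j; rewrite ord1.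
case: (unliftP ord0 j) => [k|] ->; last by rewrite !cons_rV0.
by rewrite !cons_rVS; exact: q2.2.
Qed.

Lemma measurable_cons_rV n : measurable_fun
  [set: measurableTypeR R * borel_rV R n] (@cons_rV n : _ -> borel_rV R n.+1).
Proof.
apply: (@measurability _ _ (measurableTypeR R * borel_rV R n)%type
  (borel_rV R n.+1) setT (@cons_rV n) (@open 'rV[R]_n.+1)) => //.
move=> _ [U oU <-]; rewrite setTI; apply: open_prod_measurable.
by apply: open_comp oU => p _; exact: cons_rV_continuous.
Qed.

Lemma borel_lebesgueS n (A : set (borel_rV R n.+1)) :
  borel_lebesgue A =
  (@lebesgue_measure R \x @borel_lebesgue n)%E (@cons_rV n @^-1` A).
Proof.
apply: eq_integral => x _ /=; congr borel_lebesgue.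
by apply/seteqP; split=> v; rewrite /xsection /= inE.
Qed.

Definition uncons_rV n (v : 'rV[R]_n.+1) : R * 'rV[R]_n :=
  (v ord0 ord0, \row_i v ord0 (lift ord0 i)).

Lemma cons_rVK n : cancel (@cons_rV n) (@uncons_rV n).
Proof.
move=> [x v]; rewrite /uncons_rV cons_rV0; congr pair.
by apply/rowP => i; rewrite mxE cons_rVS.
Qed.

Lemma uncons_rVK n : cancel (@uncons_rV n) (@cons_rV n).
Proof.
move=> v; apply/rowP => i; case: (unliftP ord0 i) => [k|] ->.
  by rewrite cons_rVS mxE.
by rewrite cons_rV0.
Qed.

Lemma continuous_borel m n (f : 'rV[R]_m -> 'rV[R]_n) : continuous f ->
  measurable_fun [set: borel_rV R m] (f : _ -> borel_rV R n).
Proof.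
move=> cf; apply: (@measurability _ _ (borel_rV R m)
  (borel_rV R n) setT f (@open 'rV[R]_n)) => //.
move=> _ [U oU <-]; rewrite setTI; apply: open_borel.
by apply: open_comp oU => p _; exact: cf.
Qed.

Lemma measurable_uncons_rV n : measurable_fun [set: borel_rV R n.+1]
  (@uncons_rV n : _ -> measurableTypeR R * borel_rV R n)%type.
Proof.
apply: (@measurable_fun_pair _ _ _ (borel_rV R n.+1) (measurableTypeR R) (borel_rV R n)).
  apply: (measurability _ (RGenOpens.measurableE R)).
  move=> _ [_ [a [b ->] <-]]; rewrite setTI; apply: open_borel.
  apply: (@open_comp 'rV[R]_n.+1 R (fun v => v ord0 ord0) `]a, b[%classic).
    by move=> v _; exact: coord_continuous.
  exact: interval_open.
apply: continuous_borel => v A /nbhs_ballP[e /= e0 eA].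
apply/nbhs_ballP; exists e => //= w [_ vw]; apply: eA; split => // i j.
by rewrite !mxE ord1; exact: vw.
Qed.

Lemma pack_sigma_finite d (T : measurableType d) (m : set T -> \bar R) :
  m set0 = 0%E -> (forall A, 0 <= m A)%E -> semi_sigma_additive m ->
  sigma_finite setT m ->
  exists m' : {sigma_finite_measure set T -> \bar R}, m = m'.
Proof.
move=> m0 m_ge0 madd sf.
pose i := isMeasure.Build d T R m m0 m_ge0 madd.
pose m1 : {measure set T -> \bar R} := HB.pack m i.
pose m2 : {sigma_finite_measure set T -> \bar R} :=
  HB.pack m m1 (Measure_isSigmaFinite.Build d T R m1 sf).
by exists m2.
Qed.

Lemma borel_lebesgue_measure n :
  exists m : {sigma_finite_measure set (borel_rV R n) -> \bar R},
    @borel_lebesgue n = m.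
Proof.
elim: n => [|n [m mE]].
  by exists (@dirac _ (borel_rV R 0) (0 : 'rV[R]_0) R).
pose p := measure_function_pushforward__canonical__measure_function_Measure
  (@lebesgue_measure R \x m)%E (@measurable_cons_rV n).
have pE : @borel_lebesgue n.+1 = p.
  by apply/funext => A; rewrite borel_lebesgueS mE.
rewrite pE; apply: pack_sigma_finite;
  [exact: measure0|exact: measure_ge0|exact: measure_semi_sigma_additive|].
have [F FT mF] : sigma_finite setT (@lebesgue_measure R \x m)%E.
  have /sigma_finiteP[F [TF ndF Foo]] := sigma_finiteT (@lebesgue_measure R).
  have /sigma_finiteP[G [TG ndG Goo]] := sigma_finiteT m.
  exists (fun k => F k `*` G k).
    rewrite -setXTT TF TG predeqE => -[x y]; split; last first.
      by move=> [k _ []/= ? ?]; split; exists k.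
    move=> [/= [i _ Fx] [j _ Gy]]; exists (maxn i j) => //; split.
    - by move: x Fx; exact/subsetPset/ndF/leq_maxl.
    - by move: y Gy; exact/subsetPset/ndG/leq_maxr.
  move=> k; have [? ?] := Foo k; have [? ?] := Goo k.
  split; first exact: measurableX.
  by rewrite product_measure1E// lte_mul_pinfty// ge0_fin_numE.
exists (fun k => @uncons_rV n @^-1` F k).
  by rewrite -preimage_bigcup -FT preimage_setT.
move=> k; split.
  rewrite -[X in measurable X]setTI; apply: measurable_uncons_rV => //.
  exact: (mF k).1.
rewrite /p /= /pushforward -comp_preimage.
rewrite (_ : _ \o _ = id) ?preimage_id; first exact: (mF k).2.
by apply/funext => v /=; rewrite cons_rVK.
Qed.

Let borel_lebesgue0 n : @borel_lebesgue n set0 = 0%E.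
Proof. by have [m ->] := borel_lebesgue_measure n; rewrite measure0. Qed.

Let borel_lebesgue_ge0 n A : (0 <= @borel_lebesgue n A)%E.
Proof. by have [m ->] := borel_lebesgue_measure n; rewrite measure_ge0. Qed.

Let borel_lebesgue_sigma_additive n : semi_sigma_additive (@borel_lebesgue n).
Proof.
have [m ->] := borel_lebesgue_measure n; exact: measure_semi_sigma_additive.
Qed.

HB.instance Definition _ n := isMeasure.Build _ (borel_rV R n) R
  (@borel_lebesgue n) (@borel_lebesgue0 n) (@borel_lebesgue_ge0 n)
  (@borel_lebesgue_sigma_additive n).

Let borel_lebesgue_sigma_finite n : sigma_finite setT (@borel_lebesgue n).
Proof. have [m ->] := borel_lebesgue_measure n; exact: sigma_finiteT. Qed.

HB.instance Definition _ n := Measure_isSigmaFinite.Build _ (borel_rV R n) R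
  (@borel_lebesgue n) (@borel_lebesgue_sigma_finite n).

Definition box_rV n (a b : 'rV[R]_n) : set 'rV[R]_n :=
  [set v | forall i, v ord0 i \in `[a ord0 i, b ord0 i]].

Lemma measurable_box n (a b : 'rV[R]_n) :
  measurable (box_rV a b : set (borel_rV R n)).
Proof.
have cl : closed (box_rV a b).
  have -> : box_rV a b =
      \bigcap_i [set v | `[a ord0 i, b ord0 i]%classic (v ord0 i)].
    by apply/seteqP; split=> v H i => [_|]; exact: H.
  apply: closed_bigI => i _.
  apply: (@closed_comp 'rV[R]_n R (fun v => v ord0 i)).
    by move=> v _; exact: coord_continuous.
  exact: interval_closed.
rewrite -[X in measurable X]setCK; apply: measurableC; apply: open_borel.
exact: closed_openC cl.
Qed.

Lemma borel_lebesgue_box n (a b : 'rV[R]_n) :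
  (forall i, a ord0 i <= b ord0 i) ->
  borel_lebesgue (box_rV a b) =
  (\prod_i (b ord0 i - a ord0 i))%:E.
Proof.
elim: n a b => [|n IHn] a b ab.
  rewrite big_ord0 /= diracE mem_set// => i; by case: i.
pose a' := (uncons_rV a).2; pose b' := (uncons_rV b).2.
rewrite borel_lebesgueS.
have -> : @cons_rV n @^-1` (box_rV a b) =
    `[a ord0 ord0, b ord0 ord0]%classic `*` box_rV a' b'.
  apply/seteqP; split=> [[x v] /= H|[x v] /= [Hx Hv] i].
    split; first by have := H ord0; rewrite cons_rV0.
    by move=> i; have := H (lift ord0 i); rewrite cons_rVS !mxE.
  case: (unliftP ord0 i) => [k|] ->; last by rewrite cons_rV0.
  by rewrite cons_rVS; have := Hv k; rewrite !mxE.
rewrite product_measure1E//; last exact: measurable_box.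
rewrite [X in (X * _)%E]lebesgue_measure_itv.
rewrite [X in (_ * X)%E]IHn; last by move=> i; rewrite !mxE.
rewrite /= lte_fin big_ord_recl EFinM; congr (_ * _)%E.
  case: ltP => // ba; congr EFin; apply/eqP.
  by rewrite eq_sym subr_eq0 eq_le ba ab.
by congr EFin; apply: eq_bigr => i _; rewrite !mxE.
Qed.

End borel_measure.

(* R^N is an alias of 'rV[R]_N, with the topology and (sup) norm of 'rV[R]_N;
   its measurable sets are the Lebesgue measurable ones, i.e. the Caratheodory
   sets of the outer measure induced by the Borel-Lebesgue measure.  *)
Definition Rn (R : realType) (N : nat) := 'rV[R]_N.

Section euclidean_space.
Context (R : realType) (N : nat).

HB.instance Definition _ := NormedModule.copy (Rn R N) 'rV[R]_N.
HB.instance Definition _ := Measurable.copy (Rn R N)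
  (caratheodory_type (mu_ext (@borel_lebesgue R N))).

Definition lebesgueN : set (Rn R N) -> \bar R :=
  @completed_measure_extension _ _ _ (@borel_lebesgue R N).

HB.instance Definition _ := Measure.on lebesgueN.

Let lebesgueN_sigma_finite : sigma_finite setT lebesgueN.
Proof. exact/completed_measure_extension_sigma_finite/sigma_finiteT. Qed.

HB.instance Definition _ := Measure_isSigmaFinite.Build _ (Rn R N) R
  lebesgueN lebesgueN_sigma_finite.

Lemma lebesgueN_complete : measure_is_complete lebesgueN.
Proof. exact: measure_is_complete_caratheodory. Qed.

Lemma borel_measurable_Rn (A : set (Rn R N)) :
  measurable (A : set (borel_rV R N)) -> measurable A.
Proof. by move=> mA; apply: sub_caratheodory; exact: sub_sigma_algebra. Qed.

Lemma open_measurable_Rn (A : set (Rn R N)) : open A -> measurable A.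
Proof. by move=> oA; apply: borel_measurable_Rn; exact: open_borel. Qed.

Lemma lebesgueN_borel (A : set (Rn R N)) :
  measurable (A : set (borel_rV R N)) -> lebesgueN A = borel_lebesgue A.
Proof. exact: measurable_mu_extE. Qed.

Lemma lebesgueN_box (a b : Rn R N) : (forall i, a ord0 i <= b ord0 i) ->
  lebesgueN (box_rV a b) = (\prod_i (b ord0 i - a ord0 i))%:E.
Proof.
move=> ab; rewrite lebesgueN_borel; last exact: measurable_box.
exact: borel_lebesgue_box.
Qed.

End euclidean_space.

Section nonlocal_problem.
Context {R : realType} {N : nat}.
Let mu := @lebesgueN R N.

Definition admissible_kernel (V : Rn R N -> Rn R N -> R) : Prop :=
  [/\ continuous (fun p : Rn R N * Rn R N => V p.1 p.2),
      (forall x y, 0 <= V x y),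
      (forall x, 0 < V x x),
      (forall x y, V x y = V y x) &
      (forall x, \int[mu]_y (V x y)%:E = 1)%E].

(* Elements of W are represented by functions on R^N of which only the values
   on Omega matter; two representatives are identified when [ae_eq mu Omega].
   For measurable Omega, [u \_ Omega] (u extended by 0 outside Omega) is in
   L^2(R^N) iff u is in L^2(Omega).  *)
Definition W (Omega : set (Rn R N)) (u : Rn R N -> R) : Prop :=
  u \_ Omega \in Lfun mu 2%:E /\ \int[mu]_(x in Omega) u x = 0.

Definition nonlocal_op (J G K : Rn R N -> Rn R N -> R) (A B : set (Rn R N))
    (u : Rn R N -> R) (x : Rn R N) : R :=
  \1_A x * \int[mu]_(y in A) (J x y * (u y - u x)) +
  \1_A x * \int[mu]_(y in B) (K x y * (u y - u x)) +
  \1_B x * \int[mu]_(y in A) (K x y * (u y - u x)) +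
  \1_B x * \int[mu]_(y in B) (G x y * (u y - u x)).

Definition energy (J G K : Rn R N -> Rn R N -> R) (Omega A B : set (Rn R N))
    (f v : Rn R N -> R) : R :=
  4^-1 * (\int[mu]_(x in A) \int[mu]_(y in A) (J x y * (v y - v x) ^+ 2)) +
  4^-1 * (\int[mu]_(x in B) \int[mu]_(y in B) (G x y * (v y - v x) ^+ 2)) +
  2^-1 * (\int[mu]_(x in A) \int[mu]_(y in B) (K x y * (v y - v x) ^+ 2)) +
  \int[mu]_(x in Omega) (f x * v x).

End nonlocal_problem.

(* Main.v *)
Require Import Defs.
From mathcomp Require Import all_boot all_order all_algebra.
From mathcomp Require Import all_classical all_reals all_analysis.
From mathcomp Require Import measurable_realfun ring lra.
Import Order.TTheory GRing.Theory Num.Theory numFieldNormedType.Exports.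

Set Implicit Arguments.
Unset Strict Implicit.
Unset Printing Implicit Defensive.

Local Open Scope classical_set_scope.
Local Open Scope ring_scope.

(** Extend functions on [Omega] by zero and glue the three kernels into one
    kernel [k] on [Omega * Omega]: [J] on [A * A], [G] on [B * B] and [K] on the
    two mixed blocks. It is measurable, bounded (the closure of [Omega] is
    compact), symmetric and nonnegative. With [L u x := \int k x y * (u x - u y)
    dy] the equation reads [L u = - f], and Fubini's theorem together with the
    symmetry of [k] gives
    [\int u * L v = \int v * L u], [\int L u = 0] and
    [\int u * L u = 1/2 \int \int k x y * (u y - u x) ^ 2].
    The functional is therefore [1/2 \int v * L v + \int f * v], and if
    [L u = - f] its values at [v] and at [u] differ by
    [1/2 \int (v - u) * L (v - u)].

    Everything rests on a Poincare inequality: [c * \int u ^ 2 <= \int u * L u]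
    for [u] of mean zero ([poincare_domain]). By compactness the positivity of
    the kernels on the diagonal is uniform, so [k] is bounded below for pairs of
    points at distance less than some [e > 0] ([two_phase_kernel_lower_bound]).
    If two small pieces [Q], [Q'] of [Omega] are that close, the double integral
    of [(u y - u x) ^ 2] over [Q * Q'] is controlled by the Dirichlet form; hence
    control of [\int_Q (u - a) ^ 2] propagates from [Q] to [Q']
    ([controlled_step]). The points of [Omega] whose surrounding ball is
    controlled thus form an open and closed subset of the connected set [Omega],
    and finitely many balls cover [Omega]. The boundary may be
    arbitrarily rough, since a cell only needs to have positive measure.

    Given the Poincare inequality, [u] is constructed without appeal to the
    completeness of L2, as the sum of [d_0 = - tau * f],
    [d_(n+1) = d_n - tau * L d_n]. For small [tau] each step contracts the L2
    norm ([laplacian_step_contraction]), so the series converges almost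
    everywhere and is dominated by a square-integrable function
    ([square_integrable_geometric_series]); it telescopes under [L], and
    dominated convergence passes to the limit ([solution_exists]). Uniqueness
    and minimality follow from the formula for the difference of energies and
    coercivity ([coercive_minimizer]). *)

(** * Real-valued integrable functions *)

Section real_integrals.
Context d (X : measurableType d) (R : realType).
Variable mu : {measure set X -> \bar R}.
Implicit Types u v g h : X -> R.

Definition integrableR u := mu.-integrable [set: X] (EFin \o u).

Lemma integrableR_measurable u : integrableR u -> measurable_fun [set: X] u.
Proof. by move=> /measurable_int /measurable_EFinP. Qed.

Lemma integrableR_le u g : measurable_fun [set: X] u -> integrableR g ->
  (forall x, `|u x| <= g x) -> integrableR u.
Proof.
move=> mu_ ig ug; apply: le_integrable ig => //; first exact/measurable_EFinP.
by move=> x _ /=; rewrite lee_fin (le_trans (ug x))// ler_norm.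
Qed.

Lemma integrableRD u v : integrableR u -> integrableR v ->
  integrableR (fun x => u x + v x).
Proof. by move=> iu iv; exact: (integrableD measurableT iu iv). Qed.

Lemma integrableRB u v : integrableR u -> integrableR v ->
  integrableR (fun x => u x - v x).
Proof. by move=> iu iv; exact: (integrableB measurableT iu iv). Qed.

Lemma integrableRZ c u : integrableR u -> integrableR (fun x => c * u x).
Proof. by move=> iu; exact: (integrableZl measurableT c iu). Qed.

Lemma integrableRM_bounded h u C : measurable_fun [set: X] h ->
  (forall x, `|h x| <= C) -> integrableR u -> integrableR (fun x => h x * u x).
Proof.
move=> mh hC iu; have mu_ := integrableR_measurable iu.
apply: (@integrableR_le _ (fun x => C * `|u x|)).
- exact: measurable_funM.
- exact/integrableRZ/integrable_norm.
- by move=> x; rewrite normrM ler_wpM2r.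
Qed.

Lemma integralRD u v : integrableR u -> integrableR v ->
  \int[mu]_x (u x + v x) = \int[mu]_x u x + \int[mu]_x v x.
Proof. exact: RintegralD. Qed.

Lemma integralRB u v : integrableR u -> integrableR v ->
  \int[mu]_x (u x - v x) = \int[mu]_x u x - \int[mu]_x v x.
Proof. exact: RintegralB. Qed.

Lemma integralRZ c u : integrableR u ->
  \int[mu]_x (c * u x) = c * \int[mu]_x u x.
Proof. exact: RintegralZl. Qed.

Lemma integralR_le u v : integrableR u -> integrableR v ->
  (forall x, u x <= v x) -> \int[mu]_x u x <= \int[mu]_x v x.
Proof. by move=> iu iv uv; apply: le_Rintegral => // x _; exact: uv. Qed.

Lemma integralR_ge0 u : (forall x, 0 <= u x) -> 0 <= \int[mu]_x u x.
Proof. by move=> u0; apply: Rintegral_ge0 => x _; exact: u0. Qed.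

Lemma integralR_abs u : integrableR u ->
  `|\int[mu]_x u x| <= \int[mu]_x `|u x|.
Proof. exact: le_normr_Rintegral. Qed.

Lemma EFin_integralR u : integrableR u ->
  (\int[mu]_x u x)%:E = (\int[mu]_x (u x)%:E)%E.
Proof. by move=> iu; rewrite fineK//; exact: integrable_fin_num. Qed.

Lemma integralR_ae_eq u v : integrableR u -> measurable_fun [set: X] v ->
  ae_eq mu [set: X] u v -> \int[mu]_x u x = \int[mu]_x v x.
Proof.
move=> iu mv uv; congr fine; apply: ae_eq_integral => //.
- exact/measurable_EFinP/integrableR_measurable.
- exact/measurable_EFinP.
- by apply: filterS uv => x /= H /H /= ->.
Qed.

Lemma integralR_eq0 u : (forall x, 0 <= u x) -> integrableR u ->
  \int[mu]_x u x = 0 -> ae_eq mu [set: X] u (cst 0).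
Proof.
move=> u0 iu Iu.
have : (\int[mu]_x `|(u x)%:E| = 0)%E.
  under eq_integral do rewrite gee0_abs ?lee_fin ?u0//.
  by rewrite -EFin_integralR// Iu.
move/(ae_eq_integral_abs mu measurableT (measurable_int mu iu)).
by apply: filterS => x /= H /H [].
Qed.

End real_integrals.

(** * Integral operators with a bounded kernel *)

Section bounded_kernels.
Context d (X : measurableType d) (R : realType).
Variable mu : {sigma_finite_measure set X -> \bar R}.
Variables (D : set X) (mD : measurable D) (Dfin : (mu D < +oo)%E).
Implicit Types (u v a b : X -> R) (k l : X -> X -> R).
Local Notation L1 := (integrableR mu).
Local Notation one := (\1_D : X -> R).

(** The bound contains the indicators of [D], so that [k] vanishes off [D * D]:
    integrals over [D] can then be written over the whole space. *)
Definition bounded_kernel k :=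
  measurable_fun [set: X * X] (fun p => k p.1 p.2) /\
  exists M, forall x y, `|k x y| <= M * (one x * one y).

Definition kernel_op k b x : R := \int[mu]_y (k x y * b y).

Lemma integrableR_indic (Q : set X) : measurable Q -> Q `<=` D ->
  L1 (\1_Q : X -> R).
Proof.
move=> mQ QD; apply/integrableP; split; first exact/measurable_EFinP.
under eq_integral do rewrite /= ger0_norm//.
rewrite integral_indic// setIT.
by apply: le_lt_trans Dfin; rewrite le_measure// inE.
Qed.

Let onele1 (x : X) : `|one x| <= 1.
Proof. by rewrite ger0_norm// indicE lern1 leq_b1. Qed.

Lemma measurable_kernel1 k x : bounded_kernel k ->
  measurable_fun [set: X] (k x).
Proof.
by move=> [mk _]; have := measurableT_comp mk (pair1_measurable x).
Qed.

Lemma bounded_kernel_ge0 k : bounded_kernel k ->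
  exists2 M, 0 <= M & forall x y, `|k x y| <= M * (one x * one y).
Proof.
move=> [_ [M kM]]; exists `|M| => // x y; apply: le_trans (kM x y) _.
by rewrite ler_wpM2r ?mulr_ge0// ler_norm.
Qed.

Lemma integrableR_kernel k b x : bounded_kernel k -> L1 b ->
  L1 (fun y => k x y * b y).
Proof.
move=> kk; have [M M0 kM] := bounded_kernel_ge0 kk.
apply: (@integrableRM_bounded _ _ _ _ _ _ M); first exact: measurable_kernel1.
move=> y; apply: le_trans (kM x y) _.
by rewrite ler_piMr// mulr_ile1// indicE lern1 leq_b1.
Qed.

Lemma integrable_tensor a b : L1 a -> L1 b ->
  (mu \x mu)%E.-integrable [set: X * X] (fun p => (a p.1 * b p.2)%:E).
Proof.
move=> ia ib; have ma := integrableR_measurable ia.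
have mb := integrableR_measurable ib.
apply/integrable12ltyP => /=.
  apply/measurable_EFinP/measurable_funM.
    exact: measurableT_comp ma measurable_fst.
  exact: measurableT_comp mb measurable_snd.
under eq_integral => x _.
  under eq_integral => y _ do rewrite normrM.
  rewrite -(@EFin_integralR _ _ _ mu (fun y => `|a x| * `|b y|)); last first.
    exact/integrableRZ/integrable_norm.
  rewrite integralRZ; last exact/integrable_norm.
  rewrite mulrC; over.
rewrite -(@EFin_integralR _ _ _ mu (fun x => _ * `|a x|)) ?ltry//.
exact/integrableRZ/integrable_norm.
Qed.

Lemma integrable_kernel_tensor k a b : bounded_kernel k -> L1 a -> L1 b ->
  (mu \x mu)%E.-integrable [set: X * X]
    (fun p => (a p.1 * (k p.1 p.2 * b p.2))%:E).
Proof.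
move=> kk ia ib; have [M M0 kM] := bounded_kernel_ge0 kk.
have ma := integrableR_measurable ia; have mb := integrableR_measurable ib.
apply: le_integrable (integrable_tensor (integrableRZ M ia) ib) => //.
  apply/measurable_EFinP/measurable_funM.
    exact: measurableT_comp ma measurable_fst.
  apply: measurable_funM; first exact: kk.1.
  exact: measurableT_comp mb measurable_snd.
move=> [x y] _ /=; rewrite lee_fin !normrM (ger0_norm M0) mulrCA -mulrA.
rewrite ler_wpM2r ?mulr_ge0//.
by rewrite (le_trans (kM x y))// ler_piMr// mulr_ile1// indicE lern1 leq_b1.
Qed.

Lemma kernel_op_outside k b x : bounded_kernel k -> ~ D x ->
  kernel_op k b x = 0.
Proof.
move=> [_ [M kM]] Dx; rewrite /kernel_op.
rewrite (@eq_Rintegral _ _ _ _ _ (cst 0)) ?Rintegral_cst ?mul0r// => y _ /=.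
suff -> : k x y = 0 by rewrite mul0r.
apply/normr0_eq0/le_anti; rewrite normr_ge0 andbT.
by rewrite (le_trans (kM x y))// indicE memNset// mul0r mulr0.
Qed.

Lemma kernel_op_indic k b x : bounded_kernel k ->
  kernel_op k b x = one x * kernel_op k b x.
Proof.
move=> kk; have [Dx|Dx] := pselect (D x); last first.
  by rewrite kernel_op_outside// mulr0.
by rewrite indicE mem_set// mul1r.
Qed.

Lemma integrableR_kernel_op_mul k a b : bounded_kernel k -> L1 a -> L1 b ->
  L1 (fun x => a x * kernel_op k b x).
Proof.
move=> kk ia ib.
have := integrable_fubini_F (integrable_kernel_tensor kk ia ib).
apply: eq_integrable => // x _; rewrite /fubini_F /=.
rewrite -(@EFin_integralR _ _ _ mu (fun y => a x * _)); last first.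
  exact/integrableRZ/integrableR_kernel.
by rewrite integralRZ//; exact: integrableR_kernel.
Qed.

Lemma integrableR_kernel_op k b : bounded_kernel k -> L1 b ->
  L1 (kernel_op k b).
Proof.
move=> kk ib.
have := integrableR_kernel_op_mul kk (integrableR_indic mD (@subset_refl _ D)) ib.
by apply: eq_integrable => // x _ /=; rewrite -kernel_op_indic.
Qed.

(** This pointwise bound by the L1 norm yields both the boundedness of the
    multiplier [kernel_op k \1_D] and the boundedness of the operator on L2. *)
Lemma kernel_op_le k : bounded_kernel k ->
  exists2 M, 0 <= M & forall b, L1 b -> forall x,
    `|kernel_op k b x| <= M * \int[mu]_y `|b y| * one x.
Proof.
move=> kk; have [M M0 kM] := bounded_kernel_ge0 kk.
exists M => // c ic x.
have := @integralR_abs _ _ _ mu (fun y => k x y * c y).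
move=> /(_ (integrableR_kernel x kk ic)) /le_trans; apply.
rewrite mulrAC -integralRZ; last exact: integrable_norm.
apply: integralR_le => [||y].
- exact/integrable_norm/integrableR_kernel.
- exact/integrableRZ/integrable_norm.
- rewrite normrM ler_wpM2r// (le_trans (kM x y))//.
  by rewrite ler_wpM2l// ler_piMr// indicE lern1 leq_b1.
Qed.

Lemma bounded_kernel_tr k : bounded_kernel k ->
  bounded_kernel (fun x y => k y x).
Proof.
move=> [mk [M kM]]; split.
  exact: (measurableT_comp mk (@measurable_swap _ _ X X)).
by exists M => x y; rewrite [one x * _]mulrC.
Qed.

(** Fubini's theorem: the adjoint of an integral operator has the transposed
    kernel. All symmetry properties below are deduced from this one exchange of
    integrals. *)
Lemma kernel_op_pairing k a b : bounded_kernel k -> L1 a -> L1 b ->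
  \int[mu]_x (a x * kernel_op k b x) =
  \int[mu]_y (b y * kernel_op (fun y x => k x y) a y).
Proof.
move=> kk ia ib.
have kk' := bounded_kernel_tr kk.
rewrite /Rintegral; congr fine.
have := Fubini (integrable_kernel_tensor kk ia ib).
rewrite [LHS](_ : _ = \int[mu]_x (a x * kernel_op k b x)%:E)%E; last first.
  apply: eq_integral => x _ /=.
  rewrite -(@EFin_integralR _ _ _ mu (fun y => a x * _)); last first.
    exact/integrableRZ/integrableR_kernel.
  by rewrite integralRZ//; exact: integrableR_kernel.
move=> ->; apply: eq_integral => y _ /=.
rewrite -integralRZ; last exact: (integrableR_kernel y kk' ia).
rewrite EFin_integralR; last exact/integrableRZ/(integrableR_kernel y kk' ia).
by apply: eq_integral => x _; congr EFin; ring.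
Qed.

(** * Square-integrable functions supported in [D] *)

Lemma kernel_indic k x y : bounded_kernel k -> k x y = k x y * one y.
Proof.
move=> [_ [M kM]]; have [Dy|Dy] := pselect (D y).
  by rewrite indicE mem_set// mulr1.
rewrite [one y]indicE memNset// mulr0; apply/normr0_eq0/le_anti.
by rewrite normr_ge0 andbT (le_trans (kM x y))// [one y]indicE memNset// !mulr0.
Qed.

Definition square_integrable u :=
  [/\ measurable_fun [set: X] u, L1 (fun x => u x ^+ 2) &
      forall x, ~ D x -> u x = 0].
Local Notation L2 := square_integrable.

Lemma square_integrableM u v : L2 u -> L2 v -> L1 (fun x => u x * v x).
Proof.
move=> [mu1 iu _] [mv iv _].
apply: integrableR_le (integrableRD iu iv) _ => [|x].
  exact: measurable_funM.
rewrite ler_norml; apply/andP; split; nra.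
Qed.

Lemma square_integrable_le u g : measurable_fun [set: X] u -> L2 g ->
  (forall x, `|u x| <= g x) -> L2 u.
Proof.
move=> mu_ [mg ig g0] ug; split => //.
  apply: integrableR_le ig _ => [|x]; first exact: measurable_funX.
  by rewrite normrX lerXn2r ?nnegrE ?(le_trans _ (ug x)).
by move=> x Dx; apply/normr0_eq0/le_anti; rewrite normr_ge0 andbT -(g0 x Dx) ug.
Qed.

Lemma square_integrable_indic (Q : set X) : measurable Q -> Q `<=` D ->
  L2 (\1_Q : X -> R).
Proof.
move=> mQ QD; split => //.
  rewrite (_ : (fun x => _) = (\1_Q : X -> R)); first exact: integrableR_indic.
  by apply/funext => x; rewrite indicE -natrX; case: (x \in Q).
by move=> x Dx; rewrite indicE memNset// => /QD.
Qed.

Let L2one : L2 one.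
Proof. by apply: square_integrable_indic. Qed.

Lemma square_integrable_mul_indic u x : L2 u -> u x = one x * u x.
Proof.
move=> [_ _ u0]; have [Dx|Dx] := pselect (D x).
  by rewrite indicE mem_set// mul1r.
by rewrite u0// mulr0.
Qed.

Lemma square_integrable_L1 u : L2 u -> L1 u.
Proof.
move=> u2; have := square_integrableM L2one u2.
by apply: eq_integrable => // x _ /=; rewrite -square_integrable_mul_indic.
Qed.

Lemma square_integrableZ c u : L2 u -> L2 (fun x => c * u x).
Proof.
move=> [mu1 iu u0]; split; first exact: measurable_funM.
  under eq_fun do rewrite exprMn; exact: integrableRZ.
by move=> x Dx; rewrite u0// mulr0.
Qed.

Lemma square_integrableD u v : L2 u -> L2 v -> L2 (fun x => u x + v x).
Proof.
move=> u2 v2; have iuv := square_integrableM u2 v2.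
case: u2 v2 => [mu1 iu u0] [mv iv v0]; split; first exact: measurable_funD.
  rewrite (_ : (fun x => _) = fun x => (u x ^+ 2 + 2 * (u x * v x)) + v x ^+ 2).
    apply: integrableRD => //; apply: integrableRD => //; exact: integrableRZ.
  by apply/funext => x; ring.
by move=> x Dx; rewrite u0// v0// addr0.
Qed.

Lemma square_integrableB u v : L2 u -> L2 v -> L2 (fun x => u x - v x).
Proof.
move=> u2 v2; have := square_integrableD u2 (square_integrableZ (-1) v2).
by under eq_fun do rewrite mulN1r.
Qed.

Lemma square_integrable_bounded_mul (h u : X -> R) (C : R) :
  measurable_fun [set: X] h ->
  (forall x, `|h x| <= C) -> L2 u -> L2 (fun x => h x * u x).
Proof.
move=> mh hC u2; case: (u2) => [mu1 iu u0]; split; first exact: measurable_funM.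
  under eq_fun do rewrite exprMn.
  apply: (@integrableRM_bounded _ _ _ _ _ _ (C ^+ 2)) => // [|x].
    exact: measurable_funX.
  by rewrite normrX lerXn2r ?nnegrE ?(le_trans _ (hC x)).
by move=> x Dx; rewrite u0// mulr0.
Qed.

Lemma quadratic_discr (a b c : R) : 0 <= c ->
  (forall t : R, 0 <= a - 2 * t * b + t ^+ 2 * c) -> b ^+ 2 <= a * c.
Proof.
move=> c0 H; have [c_eq0|c_neq0] := eqVneq c 0.
  have [->|b_neq0] := eqVneq b 0; first by rewrite c_eq0 expr0n mulr0.
  exfalso; have := H ((a + 1) / (2 * b)); rewrite c_eq0 mulr0 addr0.
  rewrite (_ : 2 * _ * b = a + 1); last by field.
  lra.
have cp : 0 < c by rewrite lt_neqAle eq_sym c_neq0.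
have := H (b / c); rewrite (_ : _ + _ = (a * c - b ^+ 2) / c); last by field.
by rewrite pmulr_lge0 ?invr_gt0// subr_ge0.
Qed.

Lemma cauchy_schwarz u v : L2 u -> L2 v ->
  (\int[mu]_x (u x * v x)) ^+ 2 <=
  \int[mu]_x (u x ^+ 2) * \int[mu]_x (v x ^+ 2).
Proof.
move=> u2 v2; have iuv := square_integrableM u2 v2.
case: (u2) (v2) => [_ iu _] [_ iv _].
apply: quadratic_discr => [|t]; first by apply: integralR_ge0 => x; exact: sqr_ge0.
rewrite -!integralRZ// -integralRB//; last exact: integrableRZ.
rewrite -integralRD//; last exact: integrableRZ.
  apply: integralR_ge0 => x.
  rewrite (_ : _ + _ = (u x - t * v x) ^+ 2) ?sqr_ge0//; ring.
by apply: integrableRB => //; exact: integrableRZ.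
Qed.

(** * The nonlocal Laplacian *)

(** This is [\int k x y * (u x - u y) dy] ([laplacianE]), with its two terms
    separated: a multiplication by a bounded function and an integral
    operator. The sign makes it a nonnegative operator. *)
Definition nonlocal_laplacian k u x : R :=
  kernel_op k one x * u x - kernel_op k u x.
Local Notation lap := nonlocal_laplacian.

Let iL1one : L1 one. Proof. exact: square_integrable_L1. Qed.

Lemma kernel_op_bounded k : bounded_kernel k ->
  exists C : R, forall x, `|kernel_op k one x| <= C.
Proof.
move=> kk; have [M M0 kM] := kernel_op_le kk.
exists (M * \int[mu]_y `|one y|) => x; apply: le_trans (kM _ iL1one x) _.
by rewrite ler_piMr ?mulr_ge0 ?integralR_ge0// (le_trans (ler_norm _) (onele1 x)).
Qed.

Lemma square_integrable_kernel_op k u : bounded_kernel k -> L2 u ->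
  L2 (kernel_op k u).
Proof.
move=> kk u2; have [M M0 kM] := kernel_op_le kk.
have iu := square_integrable_L1 u2.
apply: (@square_integrable_le _ (fun x => M * \int[mu]_y `|u y| * one x)).
- exact/integrableR_measurable/integrableR_kernel_op.
- exact: square_integrableZ.
- exact: kM.
Qed.

Lemma square_integrable_laplacian k u : bounded_kernel k -> L2 u -> L2 (lap k u).
Proof.
move=> kk u2; have [C kC] := kernel_op_bounded kk.
apply: square_integrableB; last exact: square_integrable_kernel_op.
apply: square_integrable_bounded_mul kC u2.
exact/integrableR_measurable/integrableR_kernel_op.
Qed.

Lemma kernel_opB k a b x : bounded_kernel k -> L1 a -> L1 b ->
  kernel_op k (fun y => a y - b y) x = kernel_op k a x - kernel_op k b x.
Proof.
move=> kk ia ib; rewrite /kernel_op.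
under eq_Rintegral do rewrite mulrBr.
by rewrite integralRB//; exact: integrableR_kernel.
Qed.

Lemma kernel_opZ k c b x : bounded_kernel k -> L1 b ->
  kernel_op k (fun y => c * b y) x = c * kernel_op k b x.
Proof.
move=> kk ib; rewrite /kernel_op.
under eq_Rintegral do rewrite mulrCA.
by rewrite integralRZ//; exact: integrableR_kernel.
Qed.

Lemma laplacianB k u v x : bounded_kernel k -> L2 u -> L2 v ->
  lap k (fun y => u y - v y) x = lap k u x - lap k v x.
Proof.
move=> kk /square_integrable_L1 iu /square_integrable_L1 iv.
by rewrite /lap kernel_opB//; ring.
Qed.

Lemma laplacianZ k c u x : bounded_kernel k -> L2 u ->
  lap k (fun y => c * u y) x = c * lap k u x.
Proof.
by move=> kk /square_integrable_L1 iu; rewrite /lap kernel_opZ//; ring.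
Qed.

Lemma integrable_kernel_increment k u x : bounded_kernel k -> L2 u ->
  L1 (fun y => k x y * (u y - u x)).
Proof.
move=> kk u2.
rewrite (_ : (fun y => _) = fun y => k x y * (u y - u x * one y)).
  apply/integrableR_kernel/square_integrable_L1 => //.
  by apply: square_integrableB => //; exact: square_integrableZ.
by apply/funext => y; rewrite (kernel_indic x y kk) indicE; case: (y \in D);
  rewrite ?(mulr0, mul0r, mulr1).
Qed.

Lemma laplacianE k u x : bounded_kernel k -> L2 u ->
  lap k u x = - \int[mu]_y (k x y * (u y - u x)).
Proof.
move=> kk /square_integrable_L1 iu; rewrite /lap /kernel_op.
rewrite mulrC -integralRZ; last exact: integrableR_kernel.
rewrite -opprB -integralRB; last 2 first.
- exact: integrableR_kernel.
- exact/integrableRZ/integrableR_kernel.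
congr (- _); apply: eq_Rintegral => y _.
by rewrite -kernel_indic//; ring.
Qed.

Lemma integrable_mul_kernel_op k u v : bounded_kernel k -> L2 u -> L2 v ->
  L1 (fun x => v x * kernel_op k u x).
Proof. by move=> kk u2 v2; apply/square_integrableM/square_integrable_kernel_op. Qed.

Lemma integrable_potential k u v : bounded_kernel k -> L2 u -> L2 v ->
  L1 (fun x => kernel_op k one x * (u x * v x)).
Proof.
move=> kk u2 v2; have [C kC] := kernel_op_bounded kk.
apply: integrableRM_bounded kC _; last exact: square_integrableM.
exact/integrableR_measurable/integrableR_kernel_op.
Qed.

Section symmetric_kernel.
Variable k : X -> X -> R.
Hypothesis kk : bounded_kernel k.
Hypothesis ksym : forall x y, k x y = k y x.

Lemma kernel_op_sym a b : L1 a -> L1 b ->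
  \int[mu]_x (a x * kernel_op k b x) = \int[mu]_x (b x * kernel_op k a x).
Proof.
move=> ia ib; rewrite (kernel_op_pairing kk ia ib).
apply: eq_Rintegral => x _; congr (_ * _).
by apply: eq_Rintegral => y _; rewrite ksym.
Qed.

Lemma laplacian_pairing u v : L2 u -> L2 v ->
  \int[mu]_x (v x * lap k u x) =
  \int[mu]_x (kernel_op k one x * (u x * v x)) -
  \int[mu]_x (v x * kernel_op k u x).
Proof.
move=> u2 v2; rewrite -integralRB.
- by apply: eq_Rintegral => x _; rewrite /lap; ring.
- exact: integrable_potential.
- exact: integrable_mul_kernel_op.
Qed.

Lemma laplacian_sym u v : L2 u -> L2 v ->
  \int[mu]_x (v x * lap k u x) = \int[mu]_x (u x * lap k v x).
Proof.
move=> u2 v2; rewrite (laplacian_pairing u2 v2) (laplacian_pairing v2 u2).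
rewrite (kernel_op_sym (square_integrable_L1 v2) (square_integrable_L1 u2)).
by congr (_ - _); apply: eq_Rintegral => x _; ring.
Qed.

(** Self-adjointness reduces this to [lap k \1_D = 0]. *)
Lemma integral_laplacian u : L2 u -> \int[mu]_x lap k u x = 0.
Proof.
move=> u2; have l2 := square_integrable_laplacian kk u2.
transitivity (\int[mu]_x (one x * lap k u x)).
  by apply: eq_Rintegral => x _; rewrite -square_integrable_mul_indic.
rewrite (laplacian_sym u2 L2one).
transitivity (\int[mu]_x (cst 0 x : R)); last by rewrite /Rintegral integral0.
apply: eq_Rintegral => x _.
by rewrite /lap [kernel_op k one x * _]mulrC -kernel_op_indic// subrr mulr0.
Qed.

Lemma laplacian_bounded : exists2 C, 0 <= C & forall u, L2 u ->
  \int[mu]_x (lap k u x ^+ 2) <= C * \int[mu]_x (u x ^+ 2).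
Proof.
have [C kC] := kernel_op_bounded kk.
have [M M0 kM] := kernel_op_le kk.
pose m := \int[mu]_x (one x ^+ 2).
exists (2 * C ^+ 2 + 2 * M ^+ 2 * m * m) => [|u u2].
  have := sqr_ge0 C; have := sqr_ge0 M; have := sqr_ge0 m; nra.
have [l2m il _] := square_integrable_laplacian kk u2.
have [um iu u0] := u2; have iL := square_integrable_L1 u2.
pose s := \int[mu]_y `|u y|.
have cs : s ^+ 2 <= \int[mu]_x (u x ^+ 2) * m.
  have au2 : L2 (fun x => `|u x|).
    split; first exact: measurableT_comp.
    - by under eq_fun do rewrite real_normK ?num_real//.
    - by move=> x Dx; rewrite u0// normr0.
  have := cauchy_schwarz au2 L2one.
  rewrite (_ : \int[mu]_x (`|u x| * one x) = s); last first.
    apply: eq_Rintegral => x _.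
    by rewrite mulrC -(square_integrable_mul_indic x au2).
  by under eq_Rintegral do rewrite real_normK ?num_real//.
apply: (@le_trans _ _ (\int[mu]_x (2 * C ^+ 2 * u x ^+ 2 +
    2 * (M * s) ^+ 2 * one x ^+ 2))).
  apply: integralR_le => // [|x].
    apply: integrableRD; first exact: integrableRZ.
    by apply: integrableRZ; case: L2one.
  have h1 := kC x; have h2 := kM _ iL x; rewrite -/s in h2.
  have : lap k u x ^+ 2 <=
      2 * (kernel_op k one x * u x) ^+ 2 + 2 * kernel_op k u x ^+ 2.
    rewrite /lap.
    by have := sqr_ge0 (kernel_op k one x * u x + kernel_op k u x); nra.
  move=> /le_trans; apply; apply: lerD.
    rewrite -mulrA ler_wpM2l// exprMn ler_wpM2r ?sqr_ge0//.
    by rewrite -[leLHS]real_normK ?num_real// lerXn2r ?nnegrE ?(le_trans _ h1).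
  rewrite -mulrA ler_wpM2l// -exprMn -[leLHS]real_normK ?num_real//.
  by rewrite lerXn2r ?nnegrE ?(le_trans _ h2).
rewrite integralRD; last 2 first.
- exact: integrableRZ.
- by apply: integrableRZ; case: L2one.
rewrite integralRZ// integralRZ; last by case: L2one.
rewrite -/m exprMn.
set U := \int[mu]_x _ in cs *.
have m0 : 0 <= m by apply: integralR_ge0 => x; exact: sqr_ge0.
have : M ^+ 2 * s ^+ 2 * m <= M ^+ 2 * (U * m) * m.
  by rewrite ler_wpM2r// ler_wpM2l ?sqr_ge0.
nra.
Qed.

End symmetric_kernel.

(** * The Dirichlet form of a kernel *)

(** For symmetric [k] this is twice the quadratic form of the Laplacian
    ([dirichlet_laplacian]). It is additive in [k], so that it can be evaluated on
    each block of a kernel separately. *)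
Definition dirichlet k u : R :=
  \int[mu]_x \int[mu]_y (k x y * (u y - u x) ^+ 2).

Let L1sqr u : L2 u -> L1 (fun x => u x ^+ 2).
Proof. by case. Qed.

Lemma dirichlet_inner k u x : bounded_kernel k -> L2 u ->
  \int[mu]_y (k x y * (u y - u x) ^+ 2) =
  kernel_op k (fun y => u y ^+ 2) x - 2 * (u x * kernel_op k u x) +
  kernel_op k one x * (u x * u x).
Proof.
move=> kk u2; have iu := square_integrable_L1 u2; have iu2 := L1sqr u2.
rewrite /kernel_op mulrA -integralRZ; last exact: integrableR_kernel.
rewrite [_ * (u x * u x)]mulrC -integralRZ; last exact: integrableR_kernel.
rewrite -integralRB; last 2 first.
- exact: integrableR_kernel.
- exact/integrableRZ/integrableR_kernel.
rewrite -integralRD; last 2 first.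
- apply: integrableRB; first exact: integrableR_kernel.
  exact/integrableRZ/integrableR_kernel.
- exact/integrableRZ/integrableR_kernel.
by apply: eq_Rintegral => y _; rewrite -kernel_indic//; ring.
Qed.

Lemma integrable_dirichlet_inner k u : bounded_kernel k -> L2 u ->
  L1 (fun x => \int[mu]_y (k x y * (u y - u x) ^+ 2)).
Proof.
move=> kk u2; under eq_fun do rewrite dirichlet_inner//.
apply: integrableRD; last exact: integrable_potential.
apply: integrableRB; first exact/integrableR_kernel_op/L1sqr.
exact/integrableRZ/integrable_mul_kernel_op.
Qed.

Lemma integrable_dirichlet_inner1 k u x : bounded_kernel k -> L2 u ->
  L1 (fun y => k x y * (u y - u x) ^+ 2).
Proof.
move=> kk u2.
rewrite (_ : (fun y => _) = fun y => k x y * (u y - u x * one y) ^+ 2).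
  apply/integrableR_kernel => //; apply: L1sqr.
  by apply: square_integrableB => //; exact: square_integrableZ.
by apply/funext => y; rewrite (kernel_indic x y kk) indicE; case: (y \in D);
  rewrite ?(mulr0,mul0r,mulr1).
Qed.

Lemma dirichletE k u : bounded_kernel k -> L2 u ->
  dirichlet k u = \int[mu]_x kernel_op k (fun y => u y ^+ 2) x -
    2 * \int[mu]_x (u x * kernel_op k u x) +
    \int[mu]_x (kernel_op k one x * (u x * u x)).
Proof.
move=> kk u2; rewrite /dirichlet.
under eq_Rintegral do rewrite dirichlet_inner//.
rewrite integralRD; last 2 first.
- apply: integrableRB; first exact/integrableR_kernel_op/L1sqr.
  exact/integrableRZ/integrable_mul_kernel_op.
- exact: integrable_potential.
rewrite integralRB; last 2 first.
- exact/integrableR_kernel_op/L1sqr.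
- exact/integrableRZ/integrable_mul_kernel_op.
by rewrite integralRZ//; exact: integrable_mul_kernel_op.
Qed.

Lemma integral_kernel_op k b : bounded_kernel k -> L1 b ->
  \int[mu]_x kernel_op k b x =
  \int[mu]_x (b x * kernel_op (fun x y => k y x) one x).
Proof.
move=> kk ib; rewrite -(kernel_op_pairing kk iL1one ib).
by apply: eq_Rintegral => x _; rewrite -kernel_op_indic.
Qed.

Lemma dirichlet_laplacian k u : bounded_kernel k ->
  (forall x y, k x y = k y x) -> L2 u ->
  dirichlet k u = 2 * \int[mu]_x (u x * lap k u x).
Proof.
move=> kk ksym u2; rewrite dirichletE// integral_kernel_op//; last exact: L1sqr.
rewrite (_ : (fun x y => k y x) = k); last by apply/funext => x; apply/funext => y.
rewrite (laplacian_pairing kk u2 u2).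
rewrite (_ : \int[mu]_x (u x ^+ 2 * _) =
  \int[mu]_x (kernel_op k one x * (u x * u x))); first by ring.
by apply: eq_Rintegral => x _; ring.
Qed.

Lemma dirichlet_tr k u : bounded_kernel k -> L2 u ->
  dirichlet (fun x y => k y x) u = dirichlet k u.
Proof.
move=> kk u2; have kk' := bounded_kernel_tr kk.
have iu := square_integrable_L1 u2.
rewrite (dirichletE kk u2) (dirichletE kk' u2).
rewrite (integral_kernel_op kk (L1sqr u2)) (integral_kernel_op kk' (L1sqr u2)).
rewrite (kernel_op_pairing kk iu iu).
set a := \int[mu]_x _; set b := \int[mu]_x _; set c := \int[mu]_x _.
set e := \int[mu]_x _; set g := \int[mu]_x _.
have -> : c = e by apply: eq_Rintegral => x _; ring.
have -> : a = g by apply: eq_Rintegral => x _; rewrite mulrC expr2.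
by ring.
Qed.

Lemma dirichlet_le k l u : bounded_kernel k -> bounded_kernel l -> L2 u ->
  (forall x y, k x y <= l x y) -> dirichlet k u <= dirichlet l u.
Proof.
move=> kk ll u2 kl; apply: integralR_le.
- exact: integrable_dirichlet_inner.
- exact: integrable_dirichlet_inner.
move=> x; apply: integralR_le.
- exact: integrable_dirichlet_inner1.
- exact: integrable_dirichlet_inner1.
by move=> y; rewrite ler_wpM2r ?sqr_ge0.
Qed.

Lemma bounded_kernelD k l : bounded_kernel k -> bounded_kernel l ->
  bounded_kernel (fun x y => k x y + l x y).
Proof.
move=> [mk [M kM]] [ml [M' lM]]; split; first exact: measurable_funD.
by exists (M + M') => x y; rewrite mulrDl (le_trans (ler_normD _ _))// lerD.
Qed.

Lemma bounded_kernelZ c k : bounded_kernel k ->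
  bounded_kernel (fun x y => c * k x y).
Proof.
move=> [mk [M kM]]; split; first exact: measurable_funM.
by exists (`|c| * M) => x y; rewrite normrM -mulrA ler_wpM2l.
Qed.

Lemma dirichletD k l u : bounded_kernel k -> bounded_kernel l -> L2 u ->
  dirichlet (fun x y => k x y + l x y) u = dirichlet k u + dirichlet l u.
Proof.
move=> kk ll u2; rewrite /dirichlet -integralRD; last 2 first.
- exact: integrable_dirichlet_inner.
- exact: integrable_dirichlet_inner.
apply: eq_Rintegral => x _; rewrite -integralRD; last 2 first.
- exact: integrable_dirichlet_inner1.
- exact: integrable_dirichlet_inner1.
by apply: eq_Rintegral => y _; rewrite mulrDl.
Qed.

Lemma dirichletZ c k u : bounded_kernel k -> L2 u ->
  dirichlet (fun x y => c * k x y) u = c * dirichlet k u.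
Proof.
move=> kk u2; rewrite /dirichlet -integralRZ; last exact: integrable_dirichlet_inner.
apply: eq_Rintegral => x _; rewrite -integralRZ; last first.
  exact: integrable_dirichlet_inner1.
by apply: eq_Rintegral => y _; rewrite mulrA.
Qed.

End bounded_kernels.

(** * Geometrically decaying series *)

Section dominated_real.
Context d (X : measurableType d) (R : realType).
Variable mu : {measure set X -> \bar R}.

Lemma dominated_integralR (u_ : nat -> X -> R) (u g : X -> R) :
  (forall n, measurable_fun [set: X] (u_ n)) -> measurable_fun [set: X] u ->
  integrableR mu g ->
  {ae mu, forall x, u_ ^~ x @ \oo --> u x} ->
  {ae mu, forall x, forall n, `|u_ n x| <= g x} ->
  \int[mu]_x u_ n x @[n --> \oo] --> \int[mu]_x u x.
Proof.
move=> mu_ mu0 ig cu ug; apply: fine_cvg.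
have [] := @dominated_convergence _ _ _ mu [set: X] measurableT
  (fun n => EFin \o u_ n) (EFin \o u) (EFin \o g).
- by move=> n; exact/measurable_EFinP.
- exact/measurable_EFinP.
- by apply: filterS cu => x cu _; apply: cvg_EFin => //; exact: nearW.
- exact: ig.
- by apply: filterS ug => x H n _ /=; rewrite lee_fin.
move=> iu _; rewrite EFin_integralR//; exact.
Qed.

End dominated_real.

Section geometric_series.
Context d (X : measurableType d) (R : realType).
Variable mu : {sigma_finite_measure set X -> \bar R}.
Variables (D : set X).
Local Notation L2 := (square_integrable mu D).

(** A weighted form of the Riesz-Fischer argument. With
    [rho < r ^ 2 < 1], the series [S := \sum_n d_n ^ 2 / r ^ (2 n)] has finite
    integral, so that [|d_n| <= sqrt S * r ^ n] almost everywhere. *)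
Lemma square_integrable_geometric_series (dd : nat -> X -> R) (a rho : R) :
  (forall n, L2 (dd n)) -> 0 < rho -> rho < 1 ->
  (forall n, \int[mu]_x (dd n x ^+ 2) <= a * rho ^+ n) ->
  exists u g, [/\ L2 u, L2 g,
    {ae mu, forall x, series (dd ^~ x) @ \oo --> u x} &
    {ae mu, forall x, forall n, `|series (dd ^~ x) n| <= g x}].
Proof.
move=> d2 rho0 rho1 da.
(* by the inequality of arithmetic and geometric means, rho < r ^ 2 < 1 *)
pose r : R := (1 + rho) / 2.
have r0 : 0 < r by rewrite /r; lra.
have r1 : r < 1 by rewrite /r; lra.
have rr : rho < r ^+ 2 by rewrite /r; nra.
pose q := rho / r ^+ 2.
have r20 : 0 < r ^+ 2 by rewrite exprn_gt0.
have q0 : 0 < q by rewrite divr_gt0.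
have q1 : q < 1 by rewrite ltr_pdivrMr// mul1r.
pose w n : R := (r ^+ 2) ^- n.
have w0 n : 0 <= w n by rewrite invr_ge0 exprn_ge0// ltW.
have L1d n : integrableR mu (fun x => dd n x ^+ 2) by case: (d2 n).
have a0 : 0 <= a.
  apply: le_trans (_ : \int[mu]_x (dd 0 x ^+ 2) <= _); last by rewrite -[a]mulr1.
  by apply: integralR_ge0 => x; exact: sqr_ge0.
pose h n x : \bar R := (w n * dd n x ^+ 2)%:E.
have h0 n x : (0 <= h n x)%E by rewrite lee_fin mulr_ge0// sqr_ge0.
have mh n : measurable_fun [set: X] (h n).
  by have /measurable_int := integrableRZ (w n) (L1d n).
pose S x : \bar R := (\sum_(0 <= n <oo) h n x)%E.
have S0 x : (0 <= S x)%E by apply: nneseries_ge0 => n _ _.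
have mS : measurable_fun [set: X] S.
  by apply: (@ge0_emeasurable_sum _ _ _ _ h xpredT).
have iS : mu.-integrable [set: X] S.
  apply/integrableP; split => //.
  under eq_integral do rewrite gee0_abs//.
  rewrite integral_nneseries//.
  apply: (@le_lt_trans _ _ (a / (1 - q))%:E); last by rewrite ltry.
  apply: lime_le.
    by apply: is_cvg_nneseries => n _ _; exact: integral_ge0.
  apply: nearW => n.
  apply: (@le_trans _ _ (series (geometric a q) n)%:E); last first.
    by rewrite lee_fin geometric_le_lim// gtr0_norm.
  rewrite /series /= -sumEFin lee_sum// => i _.
  rewrite -(@EFin_integralR _ _ _ mu (fun x => w i * dd i x ^+ 2)); last first.
    exact: integrableRZ.
  rewrite lee_fin integralRZ// (_ : a * q ^+ i = w i * (a * rho ^+ i)).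
    by rewrite ler_wpM2l.
  by rewrite /q /w expr_div_n; ring.
pose E := [set x | (S x < +oo)%E].
have mE : measurable E.
  by rewrite -[E]setTI; exact: emeasurable_fun_infty_o.
have aeE : {ae mu, forall x, E x}.
  apply: filterS (integrable_ae measurableT iS) => x /(_ I).
  by rewrite ge0_fin_numE.
pose H x := Num.sqrt (fine (S x)).
have mfS : measurable_fun [set: X] (fine \o S).
  by apply: measurableT_comp mS; exact: fine_measurable.
have S_out x : ~ D x -> S x = 0%E.
  move=> Dx; apply: eseries0 => n _ _; rewrite /h.
  by case: (d2 n) => _ _ ->//; rewrite expr0n mulr0.
have H2 : L2 H.
  split.
  - apply: measurableT_comp mfS; apply: continuous_measurable_fun.
    exact: sqrt_continuous.
  - apply: le_integrable iS => //.
      apply/measurable_EFinP; under eq_fun do rewrite sqr_sqrtr ?fine_ge0//.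
      exact: mfS.
    move=> x _ /=; rewrite sqr_sqrtr ?fine_ge0// ger0_norm ?fine_ge0//.
    rewrite gee0_abs//; have := S0 x; case: (S x) => //= *; rewrite ?lexx ?leey//.
  - by move=> x Dx; rewrite /H S_out// sqrtr0.
have dH n x : E x -> `|dd n x| <= H x * r ^+ n.
  move=> Ex; have rn0 : 0 <= r ^+ n by rewrite exprn_ge0// ltW.
  rewrite -[r ^+ n](ger0_norm rn0) -!sqrtr_sqr -sqrtrM ?fine_ge0// ler_wsqrtr//.
  have hS : (h n x <= S x)%E.
    apply: le_trans (nneseries_lim_ge n.+1 _) => //.
    by rewrite big_nat_recr//= leeDr// sume_ge0.
  rewrite -exprM mulnC exprM -ler_pdivrMr ?exprn_gt0// mulrC.
  by rewrite -lee_fin fineK// ge0_fin_numE.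
(* cutting off the null set where S is infinite gives convergence everywhere,
   hence a measurable limit *)
pose v n x := \1_E x * series (dd ^~ x) n.
pose g x := (1 - r)^-1 * H x.
have r1' : 0 < 1 - r by rewrite subr_gt0.
have H0 x : 0 <= H x by exact: sqrtr_ge0.
have serb n x : E x -> \sum_(0 <= i < n) `|dd i x| <= g x.
  move=> Ex; apply: (@le_trans _ _ (series (geometric (H x) r) n)).
    by apply: ler_sum => i _; exact: dH.
  by rewrite /g mulrC geometric_le_lim// gtr0_norm.
have vg n x : `|v n x| <= g x.
  rewrite /v; have [Ex|Ex] := pselect (E x).
    rewrite indicE mem_set// mul1r; apply: le_trans (serb n x Ex).
    exact: ler_norm_sum.
  by rewrite indicE memNset// mul0r normr0 mulr_ge0// invr_ge0 ltW.
have cv x : cvgn (v ^~ x).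
  rewrite /v; have [Ex|Ex] := pselect (E x); last first.
    by rewrite indicE memNset//; under eq_fun do rewrite mul0r; exact: is_cvg_cst.
  rewrite indicE mem_set//; under eq_fun do rewrite mul1r.
  apply: normed_cvg; apply: (@series_le_cvg _ _ (geometric (H x) r)) => [n|n|n|].
  - exact: normr_ge0.
  - by apply: mulr_ge0 => //; rewrite exprn_ge0// ltW.
  - exact: dH.
  - by apply: is_cvg_geometric_series; rewrite gtr0_norm.
have mv n : measurable_fun [set: X] (v n).
  apply: measurable_funM => //.
  by apply: measurable_sum => i; case: (d2 i).
pose u x := limn (v ^~ x).
have mu_ : measurable_fun [set: X] u.
  by apply: measurable_fun_cvg mv _ => x _; exact: cv.
have g2 : L2 g by exact: square_integrableZ.
have ug x : `|u x| <= g x.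
  rewrite /u -lim_norm//; apply: limr_le; first exact: is_cvg_norm.
  by apply: nearW => n; exact: vg.
exists u, g; split => //.
- exact: square_integrable_le g2 ug.
- apply: filterS aeE => x Ex.
  have <- : v ^~ x = series (dd ^~ x).
    by apply/funext => n; rewrite /v indicE mem_set// mul1r.
  exact: cv.
- apply: filterS aeE => x Ex n; apply: le_trans (serb n x Ex).
  exact: ler_norm_sum.
Qed.

End geometric_series.

(** * Existence and minimality under coercivity *)

Section coercive_problem.
Context d (X : measurableType d) (R : realType).
Variable mu : {sigma_finite_measure set X -> \bar R}.
Variables (D : set X) (mD : measurable D) (Dfin : (mu D < +oo)%E).
Variable k : X -> X -> R.
Hypothesis kk : bounded_kernel D k.
Hypothesis ksym : forall x y, k x y = k y x.
Local Notation L2 := (square_integrable mu D).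
Local Notation lap := (nonlocal_laplacian mu D k).

Let L2_L1 u : L2 u -> integrableR mu u.
Proof. exact: square_integrable_L1. Qed.

Let L2_M u v : L2 u -> L2 v -> integrableR mu (fun x => u x * v x).
Proof. exact: square_integrableM. Qed.

Definition mean_zero u := L2 u /\ \int[mu]_x u x = 0.

Lemma mean_zeroB u v : mean_zero u -> mean_zero v ->
  mean_zero (fun x => u x - v x).
Proof.
move=> [u2 u0] [v2 v0]; split; first exact: square_integrableB.
by rewrite integralRB ?u0 ?v0 ?subrr//; exact: L2_L1.
Qed.

Lemma mean_zeroZ c u : mean_zero u -> mean_zero (fun x => c * u x).
Proof.
move=> [u2 u0]; split; first exact: square_integrableZ.
by rewrite integralRZ ?u0 ?mulr0//; exact: L2_L1.
Qed.

Lemma mean_zero_laplacian u : mean_zero u -> mean_zero (lap u).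
Proof.
move=> [u2 u0]; split; first exact: square_integrable_laplacian.
exact: integral_laplacian.
Qed.

Variable c : R.
Hypothesis c0 : 0 < c.
Hypothesis coercive : forall u, mean_zero u ->
  c * \int[mu]_x (u x ^+ 2) <= \int[mu]_x (u x * lap u x).

(** One step of the iteration [u - tau * (lap u + f)] contracts squared norms
    for small [tau]: the cross term is controlled from below by coercivity and
    the quadratic term from above by boundedness. *)
Lemma laplacian_step_contraction : exists tau rho : R,
  [/\ 0 < tau, 0 < rho, rho < 1 & forall u, mean_zero u ->
  \int[mu]_x ((u x - tau * lap u x) ^+ 2) <= rho * \int[mu]_x (u x ^+ 2)].
Proof.
have [C C0 lC] := laplacian_bounded mD Dfin kk.
pose C' := C + c ^+ 2 + 1.
have C'0 : 0 < C' by have := sqr_ge0 c; rewrite /C'; lra.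
pose tau := c / C'.
have tau0 : 0 < tau by rewrite divr_gt0.
(* 1 - 2 * c * tau + C * tau ^ 2 <= 1 - c * tau, because tau * C <= c *)
exists tau, (1 - c * tau); split => //.
- rewrite subr_gt0 /tau mulrA ltr_pdivrMr// /C'; lra.
- by rewrite ltrBlDr ltrDl mulr_gt0.
move=> u mzu; have [u2 _] := mzu.
have l2 := square_integrable_laplacian mD Dfin kk u2.
have iul := L2_M u2 l2.
have [[_ iu _] [_ il _]] := (u2, l2).
rewrite (_ : \int[mu]_x _ = \int[mu]_x (u x ^+ 2) -
    2 * tau * \int[mu]_x (u x * lap u x) + tau ^+ 2 * \int[mu]_x (lap u x ^+ 2)).
  have h1 := coercive mzu; have h2 := lC _ u2.
  set U := \int[mu]_x (u x ^+ 2) in h1 h2 *.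
  set q := \int[mu]_x _ in h1 *; set l := \int[mu]_x _ in h2 *.
  have U0 : 0 <= U by apply: integralR_ge0 => x; exact: sqr_ge0.
  have h3 : tau ^+ 2 * l <= tau * c * U.
    have -> : tau * c = tau ^+ 2 * C' by rewrite /tau; field; lra.
    rewrite -mulrA ler_wpM2l ?sqr_ge0// (le_trans h2)// ler_wpM2r// /C'.
    have := sqr_ge0 c; lra.
  have h4 : tau * (c * U) <= tau * q by rewrite ler_wpM2l// ltW.
  lra.
rewrite -integralRZ// -[tau ^+ 2 * _]integralRZ// -integralRB//; last first.
  exact: integrableRZ.
rewrite -integralRD; last 2 first.
- by apply: integrableRB => //; exact: integrableRZ.
- exact: integrableRZ.
by apply: eq_Rintegral => x _; ring.
Qed.

Lemma kernel_op_cvg (u_ : nat -> X -> R) (u g : X -> R) x :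
  (forall n, L2 (u_ n)) -> L2 u -> L2 g ->
  {ae mu, forall x, u_ ^~ x @ \oo --> u x} ->
  {ae mu, forall x, forall n, `|u_ n x| <= g x} ->
  kernel_op mu k (u_ n) x @[n --> \oo] --> kernel_op mu k u x.
Proof.
move=> u_2 u2 g2 cu ug; have [M M0 kM] := bounded_kernel_ge0 kk.
apply: (@dominated_integralR _ _ _ _ (fun n y => k x y * u_ n y) _
  (fun y => M * g y)).
- by move=> n; apply/integrableR_measurable/(integrableR_kernel _ kk)/L2_L1.
- by apply/integrableR_measurable/(integrableR_kernel _ kk)/L2_L1.
- exact/integrableRZ/L2_L1.
- apply: filterS cu => y cu; exact: cvgMr.
- apply: filterS ug => y ug n; rewrite normrM ler_pM//.
  rewrite (le_trans (kM x y))// ler_piMr// !indicE -natrM lern1.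
Qed.

Lemma solution_exists f : mean_zero f ->
  exists2 u, mean_zero u & ae_eq mu [set: X] (lap u) (fun x => - f x).
Proof.
move=> mzf; have [tau [rho [tau0 rho0 rho1 contr]]] := laplacian_step_contraction.
pose dd := fix dd n := if n is n'.+1 then
  (fun x => dd n' x - tau * lap (dd n') x) else (fun x => - tau * f x).
have mzd n : mean_zero (dd n).
  elim: n => [|n IH] /=; first exact: mean_zeroZ.
  exact/mean_zeroB/mean_zeroZ/mean_zero_laplacian.
have d2 n : L2 (dd n) by have [] := mzd n.
pose a := \int[mu]_x (dd 0 x ^+ 2).
have da n : \int[mu]_x (dd n x ^+ 2) <= a * rho ^+ n.
  elim: n => [|n IH]; first by rewrite mulr1.
  rewrite /= (le_trans (contr _ (mzd n)))// exprS mulrCA ler_wpM2l//.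
  exact: ltW.
have [u [g [u2 g2 cu ug]]] := square_integrable_geometric_series d2 rho0 rho1 da.
pose v n x := series (dd ^~ x) n.
have vS n : v n.+1 = fun x => v n x + dd n x.
  by apply/funext => x; rewrite /v /series /= big_nat_recr.
have v0 : v 0 = fun x => 0 * dd 0 x.
  by apply/funext => x; rewrite /v /series /= big_geq// mul0r.
have v2 n : L2 (v n).
  elim: n => [|n IH]; first by rewrite v0; exact: square_integrableZ.
  by rewrite vS; exact: square_integrableD.
have iv n : \int[mu]_x v n x = 0.
  elim: n => [|n IH].
    by rewrite v0 integralRZ ?mul0r//; exact: L2_L1.
  rewrite vS integralRD; try exact: L2_L1.
  by rewrite IH add0r; have [] := mzd n.
(* telescoping, since d_(n+1) = d_n - tau * lap d_n *)
have lv n x : lap (v n) x = - f x - tau^-1 * dd n x.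
  elim: n => [|n IH].
    rewrite v0 (laplacianZ mD Dfin 0 x kk (d2 0)) mul0r /=; field.
    by rewrite gt_eqF.
  rewrite vS (_ : (fun x => _) = (fun x => v n x - -1 * dd n x)); last first.
    by apply/funext => y; ring.
  rewrite laplacianB//; last exact: square_integrableZ.
  by rewrite IH laplacianZ//=; field; rewrite gt_eqF.
exists u.
  split=> //; have : \int[mu]_x v n x @[n --> \oo] --> \int[mu]_x u x.
    apply: dominated_integralR cu ug => [n||].
    - by case: (v2 n).
    - by case: u2.
    - exact: L2_L1.
  under eq_fun do rewrite iv.
  by move=> /cvg_lim <-//; exact: lim_cst.
apply: filterS (cu) => x cux _.
have cd : dd n x @[n --> \oo] --> 0 := cvg_series_cvg_0 (cvgP _ cux).
have c1 : lap (v n) x @[n --> \oo] --> - f x.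
  under eq_fun do rewrite lv.
  have : - f x - tau^-1 * dd n x @[n --> \oo] --> - f x - tau^-1 * 0.
    by apply: cvgB; [exact: cvg_cst|exact: cvgMr].
  by rewrite mulr0 subr0.
have c2 : lap (v n) x @[n --> \oo] --> lap u x.
  apply: cvgB; first exact: cvgMr.
  exact: kernel_op_cvg v2 u2 g2 cu ug.
rewrite -(cvg_lim _ c2)//; exact: cvg_lim c1.
Qed.

(** Coercivity makes the energy of a difference definite. *)
Lemma coercive_ae_eq u v : mean_zero u -> mean_zero v ->
  \int[mu]_x ((u x - v x) * lap (fun x => u x - v x) x) <= 0 ->
  ae_eq mu [set: X] u v.
Proof.
move=> zu zv q0; have zw := mean_zeroB zu zv.
have w0 : \int[mu]_x ((u x - v x) ^+ 2) = 0.
  apply/le_anti/andP; split; last by apply: integralR_ge0 => x; exact: sqr_ge0.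
  by rewrite -(pmulr_rle0 _ c0) (le_trans (coercive zw)).
have [[_ iw _] _] := zw.
have := integralR_eq0 (fun x => sqr_ge0 (u x - v x)) iw w0.
apply: filterS => x H _; have /eqP := H I.
by rewrite sqrf_eq0 subr_eq0 => /eqP.
Qed.

Definition laplacian_energy f v : R :=
  2^-1 * \int[mu]_x (v x * lap v x) + \int[mu]_x (f x * v x).

(** When [u] solves the equation, the first-order term of the expansion of the
    energy around [u] vanishes, and only the quadratic form remains. *)
Lemma laplacian_energyB f u v : mean_zero f -> mean_zero u -> mean_zero v ->
  ae_eq mu [set: X] (lap u) (fun x => - f x) ->
  laplacian_energy f v - laplacian_energy f u =
  2^-1 * \int[mu]_x ((v x - u x) * lap (fun x => v x - u x) x).
Proof.
move=> [f2 _] [u2 _] [v2 _] luf.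
have lu2 := square_integrable_laplacian mD Dfin kk u2.
have lv2 := square_integrable_laplacian mD Dfin kk v2.
have fE w : L2 w -> \int[mu]_x (f x * w x) = - \int[mu]_x (w x * lap u x).
  move=> w2; rewrite -mulN1r -integralRZ; last exact: L2_M.
  apply: integralR_ae_eq; first exact: L2_M.
    apply/integrableR_measurable/integrableRZ; exact: L2_M w2 lu2.
  by apply: filterS luf => x H _; rewrite (H I); ring.
rewrite /laplacian_energy !fE//.
rewrite (_ : \int[mu]_x ((v x - u x) * _) = \int[mu]_x (v x * lap v x) -
  \int[mu]_x (v x * lap u x) - \int[mu]_x (u x * lap v x) +
  \int[mu]_x (u x * lap u x)).
  have := laplacian_sym mD Dfin kk ksym v2 u2.
  move: (\int[mu]_x (v x * lap v x)) (\int[mu]_x (v x * lap u x)) => a b.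
  move: (\int[mu]_x (u x * lap v x)) (\int[mu]_x (u x * lap u x)) => a' b'.
  by move=> ->; field.
rewrite -!integralRB -?integralRD; try exact: L2_M.
- apply: eq_Rintegral => x _; rewrite laplacianB//; ring.
- by apply: integrableRB; [apply: integrableRB|]; exact: L2_M.
- by apply: integrableRB; exact: L2_M.
Qed.

(** A second solution [w] has energy at most that of [u], by exchanging the two
    in [laplacian_energyB]; so the uniqueness of the solution is a case of the
    uniqueness of the minimizer. *)
Theorem coercive_minimizer f : mean_zero f -> exists2 u, mean_zero u &
  [/\ ae_eq mu [set: X] (lap u) (fun x => - f x),
    (forall w, mean_zero w -> ae_eq mu [set: X] (lap w) (fun x => - f x) ->
       ae_eq mu [set: X] w u),
    (forall v, mean_zero v -> laplacian_energy f u <= laplacian_energy f v) &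
    (forall w, mean_zero w ->
       laplacian_energy f w <= laplacian_energy f u -> ae_eq mu [set: X] w u)].
Proof.
move=> zf; have [u zu luf] := solution_exists zf.
have minu v : mean_zero v -> laplacian_energy f u <= laplacian_energy f v.
  move=> zv; rewrite -subr_ge0 (laplacian_energyB zf zu zv luf) mulr_ge0//.
  apply: le_trans (coercive (mean_zeroB zv zu)); apply: mulr_ge0; first exact: ltW.
  by apply: integralR_ge0 => x; exact: sqr_ge0.
have uniq w : mean_zero w -> laplacian_energy f w <= laplacian_energy f u ->
    ae_eq mu [set: X] w u.
  move=> zw; rewrite -subr_le0 (laplacian_energyB zf zu zw luf).
  by rewrite pmulr_rle0 ?invr_gt0//; exact: coercive_ae_eq.
exists u => //; split => // w zw lwf; apply: uniq => //.
rewrite -subr_ge0 (laplacian_energyB zf zw zu lwf) mulr_ge0//.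
apply: le_trans (coercive (mean_zeroB zu zw)); apply: mulr_ge0; first exact: ltW.
by apply: integralR_ge0 => x; exact: sqr_ge0.
Qed.

End coercive_problem.

(** * Propagation of a Poincare inequality *)

(** Here [m], [s], [A] are the integrals of [1], [u], [u ^ 2] over a set [Q], and
    [m'], [s'], [A'] those over [Q']: integrate
    [(u y - a) ^ 2 <= 2 * (u y - u x) ^ 2 + 2 * (u x - a) ^ 2] over [x] in [Q] and
    [y] in [Q']. The last two hypotheses are the Cauchy-Schwarz inequalities. *)
Lemma moment_chain (R : realFieldType) (m s A m' s' A' a : R) :
  0 < m -> 0 <= m' -> 0 <= A' -> s ^+ 2 <= m * A -> s' ^+ 2 <= m' * A' ->
  m * (A' - 2 * a * s' + a ^+ 2 * m') <=
  2 * (m * A' - 2 * s * s' + A * m') + 2 * m' * (A - 2 * a * s + a ^+ 2 * m).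
Proof.
move=> m0 m'0 A'0 sA sA'; rewrite -subr_ge0.
set e := (X in 0 <= X).
have [m'E|m'N] := eqVneq m' 0.
  have s'E : s' = 0.
    apply/eqP; rewrite -sqrf_eq0 -(le_anti (_ : 0 <= s' ^+ 2 <= 0)) ?sqr_ge0//.
    by move: sA'; rewrite m'E mul0r.
  have -> : e = m * A' by rewrite /e m'E s'E; ring.
  by rewrite mulr_ge0// ltW.
have m'p : 0 < m' by rewrite lt_neqAle eq_sym m'N.
rewrite -(pmulr_rge0 _ (mulr_gt0 m0 m'p)).
have h1 : m' ^+ 2 * s ^+ 2 <= m' ^+ 2 * (m * A) by rewrite ler_wpM2l ?sqr_ge0.
have h2 : m ^+ 2 * s' ^+ 2 <= m ^+ 2 * (m' * A') by rewrite ler_wpM2l ?sqr_ge0.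
(* up to variance terms, the difference is a perfect square *)
have h3 := sqr_ge0 (m * s' - 2 * m' * s + m * m' * a).
rewrite /e; lra.
Qed.

Section poincare.
Context d (X : measurableType d) (R : realType).
Variable mu : {sigma_finite_measure set X -> \bar R}.
Variables (D : set X) (mD : measurable D) (Dfin : (mu D < +oo)%E).
Variable k : X -> X -> R.
Hypothesis kk : bounded_kernel D k.
Hypothesis k0 : forall x y, 0 <= k x y.
Local Notation L2 := (square_integrable mu D).
Implicit Types (Q : set X) (u : X -> R).

Definition mass Q : R := \int[mu]_x (\1_Q x : R).
Definition moment1 Q u : R := \int[mu]_x (\1_Q x * u x).
Definition moment2 Q u : R := \int[mu]_x (\1_Q x * u x ^+ 2).
Definition deviation Q u (a : R) : R := \int[mu]_x (\1_Q x * (u x - a) ^+ 2).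

Let indic_sqr Q x : (\1_Q x : R) ^+ 2 = \1_Q x.
Proof. by rewrite indicE -natrX; case: (x \in Q). Qed.

Let indic_le1 Q x : `|\1_Q x : R| <= 1.
Proof. by rewrite ger0_norm// indicE lern1 leq_b1. Qed.

Lemma integrable_indic_mul Q (h : X -> R) : measurable Q -> integrableR mu h ->
  integrableR mu (fun x => \1_Q x * h x).
Proof. by move=> mQ; exact: integrableRM_bounded (indic_le1 Q). Qed.

Lemma bounded_kernel_indic Q Q' : measurable Q -> measurable Q' ->
  Q `<=` D -> Q' `<=` D ->
  bounded_kernel D (fun x y => \1_Q x * \1_Q' y : R).
Proof.
move=> mQ mQ' QD Q'D; split.
  apply: measurable_funM; first exact: measurableT_comp measurable_fst.
  exact: measurableT_comp measurable_snd.
exists 1 => x y; rewrite mul1r ger0_norm ?mulr_ge0// ler_pM//.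
  by rewrite !indicE ler_nat; case: (boolP (x \in Q)) => // /set_mem /QD /mem_set ->.
by rewrite !indicE ler_nat; case: (boolP (y \in Q')) => // /set_mem /Q'D /mem_set ->.
Qed.

Lemma integrable_deviation Q u a : measurable Q -> Q `<=` D -> L2 u ->
  integrableR mu (fun x => \1_Q x * (u x - a) ^+ 2).
Proof.
move=> mQ QD u2.
rewrite (_ : (fun y => _) = fun y => \1_Q y * (u y - a * \1_D y) ^+ 2).
  apply: integrable_indic_mul => //.
  have [] // : L2 (fun y => u y - a * \1_D y).
  apply: square_integrableB => //.
  exact/square_integrableZ/square_integrable_indic.
apply/funext => y; rewrite !indicE.
case: (boolP (y \in Q)) => [/set_mem/QD/mem_set ->|_]; last by rewrite !mul0r.
by rewrite mulr1.
Qed.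

Lemma deviationE Q u a : measurable Q -> Q `<=` D -> L2 u ->
  deviation Q u a = moment2 Q u - 2 * a * moment1 Q u + a ^+ 2 * mass Q.
Proof.
move=> mQ QD u2; have iu := square_integrable_L1 mD Dfin u2.
have iQ : integrableR mu (\1_Q : X -> R) := integrableR_indic mD Dfin mQ QD.
have iu2 : integrableR mu (fun x => u x ^+ 2) by case: u2.
have i1 := integrable_indic_mul mQ iu; have i2 := integrable_indic_mul mQ iu2.
rewrite /moment2 /moment1 /mass -!integralRZ// -integralRB//; last first.
  exact: integrableRZ.
rewrite -integralRD; last exact: integrableRZ.
  by apply: eq_Rintegral => x _; ring.
by apply: integrableRB => //; exact: integrableRZ.
Qed.

(** The double integral of [(u y - u x) ^ 2] over [Q * Q'], in terms of the
    moments; the Dirichlet form dominates it where the kernel is bounded below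
    ([dirichlet_cells_le]). *)
Lemma dirichlet_indic Q Q' u : measurable Q -> measurable Q' ->
  Q `<=` D -> Q' `<=` D -> L2 u ->
  dirichlet mu (fun x y => \1_Q x * \1_Q' y) u =
  mass Q * moment2 Q' u - 2 * moment1 Q u * moment1 Q' u +
  moment2 Q u * mass Q'.
Proof.
move=> mQ mQ' QD Q'D u2; have iu := square_integrable_L1 mD Dfin u2.
have iQ : integrableR mu (\1_Q : X -> R) := integrableR_indic mD Dfin mQ QD.
have iQ' : integrableR mu (\1_Q' : X -> R) := integrableR_indic mD Dfin mQ' Q'D.
have iu2 : integrableR mu (fun x => u x ^+ 2) by case: u2.
have i1 := integrable_indic_mul mQ iu; have i2 := integrable_indic_mul mQ iu2.
transitivity (\int[mu]_x (moment2 Q' u * \1_Q x -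
    2 * moment1 Q' u * (\1_Q x * u x) + mass Q' * (\1_Q x * u x ^+ 2))).
  apply: eq_Rintegral => x _.
  transitivity (\int[mu]_y (\1_Q x * (\1_Q' y * (u y - u x) ^+ 2))).
    by apply: eq_Rintegral => y _; rewrite mulrA.
  rewrite integralRZ; last exact: integrable_deviation.
  by rewrite -[X in _ * X]/(deviation Q' u (u x)) deviationE//; ring.
rewrite integralRD; last 2 first.
- by apply: integrableRB; exact: integrableRZ.
- exact: integrableRZ.
rewrite integralRB; [|exact: integrableRZ|exact: integrableRZ].
by rewrite !integralRZ// /mass /moment1 /moment2; ring.
Qed.

Lemma mass_ge0 Q : 0 <= mass Q.
Proof. exact: integralR_ge0. Qed.

Lemma moment2_ge0 Q u : 0 <= moment2 Q u.
Proof. by apply: integralR_ge0 => x; rewrite mulr_ge0// sqr_ge0. Qed.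

Lemma moment1_sqr_le Q u : measurable Q -> Q `<=` D -> L2 u ->
  moment1 Q u ^+ 2 <= mass Q * moment2 Q u.
Proof.
move=> mQ QD u2.
have Q2 := square_integrable_indic mD Dfin mQ QD : L2 (\1_Q : X -> R).
have Qu2 : L2 (fun x => \1_Q x * u x).
  exact: square_integrable_bounded_mul (indic_le1 Q) u2.
have := cauchy_schwarz Q2 Qu2.
rewrite (_ : \int[mu]_x (\1_Q x * (\1_Q x * u x)) = moment1 Q u); last first.
  by apply: eq_Rintegral => x _; rewrite mulrA -expr2 indic_sqr.
rewrite (_ : \int[mu]_x (\1_Q x ^+ 2) = mass Q); last first.
  by apply: eq_Rintegral => x _; rewrite indic_sqr.
rewrite (_ : \int[mu]_x ((\1_Q x * u x) ^+ 2) = moment2 Q u)//.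
by apply: eq_Rintegral => x _; rewrite exprMn indic_sqr.
Qed.

Lemma dirichlet_cells_le Q Q' u eta : measurable Q -> measurable Q' ->
  Q `<=` D -> Q' `<=` D -> L2 u ->
  (forall x y, Q x -> Q' y -> eta <= k x y) ->
  eta * dirichlet mu (fun x y => \1_Q x * \1_Q' y) u <= dirichlet mu k u.
Proof.
move=> mQ mQ' QD Q'D u2 ek; have bk := bounded_kernel_indic mQ mQ' QD Q'D.
rewrite -(dirichletZ mD Dfin)//; apply: (dirichlet_le mD Dfin) => //.
  exact: bounded_kernelZ.
move=> x y; rewrite !indicE.
case: (boolP (x \in Q)) => [/set_mem Qx|_]; last by rewrite mul0r mulr0.
case: (boolP (y \in Q')) => [/set_mem Qy|_]; last by rewrite mulr0 mulr0.
by rewrite !mulr1; exact: ek.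
Qed.

(** The reference value [a u] may depend on [u] but is the same for all sets
    [E]: this is what allows the property to pass to unions. In the end [a u] is
    the mean of [u] over one fixed cell. *)
Definition controlled (a : (X -> R) -> R) (E : set X) :=
  [/\ measurable E, E `<=` D & exists2 C, 0 <= C & forall u, L2 u ->
    deviation E u (a u) <= C * dirichlet mu k u].

Lemma dirichlet_ge0 u : 0 <= dirichlet mu k u.
Proof.
by apply: integralR_ge0 => x; apply: integralR_ge0 => y; rewrite mulr_ge0 ?sqr_ge0.
Qed.

(** The deviation from the mean over [Q] is, up to the factor [2 * mass Q], the
    double integral of [(u y - u x) ^ 2] over [Q * Q]. *)
Lemma controlled_start Q eta : measurable Q -> Q `<=` D -> 0 < mass Q ->
  0 < eta -> (forall x y, Q x -> Q y -> eta <= k x y) ->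
  controlled (fun u => moment1 Q u / mass Q) Q.
Proof.
move=> mQ QD Q0 eta0 ek; split => //.
exists (eta^-1 / mass Q) => [|u u2].
  by rewrite mulr_ge0 ?invr_ge0 ?ltW.
have := dirichlet_cells_le mQ mQ QD QD u2 ek.
rewrite deviationE// dirichlet_indic//.
have := moment1_sqr_le mQ QD u2; move: (dirichlet mu k u) Q0.
move: (mass Q) (moment1 Q u) (moment2 Q u) => m s A q m0 sA h.
rewrite (_ : A - _ + _ = (m * A - s ^+ 2) / m); last by field; rewrite gt_eqF.
rewrite mulrAC ler_pM2r ?invr_gt0// ler_pdivlMl//.
apply: le_trans h; apply: ler_wpM2l; first exact: ltW.
lra.
Qed.

(** By [moment_chain] with [a := a u]. *)
Lemma controlled_step a Q Q' eta : controlled a Q -> measurable Q' ->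
  Q' `<=` D -> 0 < mass Q -> 0 < eta ->
  (forall x y, Q x -> Q' y -> eta <= k x y) -> controlled a Q'.
Proof.
move=> [mQ QD [C C0 CQ]] mQ' Q'D Q0 eta0 ek; split => //.
exists ((2 * eta^-1 + 2 * mass Q' * C) / mass Q) => [|u u2].
  apply: mulr_ge0; last by rewrite invr_ge0 ltW.
  apply: addr_ge0; first by rewrite mulr_ge0// invr_ge0 ltW.
  by rewrite !mulr_ge0// mass_ge0.
have h1 := dirichlet_cells_le mQ mQ' QD Q'D u2 ek.
have h2 := CQ u u2.
have := moment_chain (a u) Q0 (mass_ge0 Q') (moment2_ge0 Q' u)
  (moment1_sqr_le mQ QD u2) (moment1_sqr_le mQ' Q'D u2).
rewrite -!deviationE// -dirichlet_indic// => h3.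
rewrite mulrAC ler_pdivlMr// mulrC; apply: (le_trans h3).
rewrite [leRHS]mulrDl; apply: lerD.
  by rewrite -mulrA ler_wpM2l// ler_pdivlMl.
by rewrite -!mulrA ler_wpM2l// ler_wpM2l ?mass_ge0.
Qed.

Lemma controlledU a E F : controlled a E -> controlled a F ->
  controlled a (E `|` F).
Proof.
move=> [mE ED [C C0 CE]] [mF FD [C' C'0 CF]]; split.
- exact: measurableU.
- by move=> x [/ED|/FD].
exists (C + C') => [|u u2]; first exact: addr_ge0.
rewrite mulrDl; apply: le_trans (lerD (CE u u2) (CF u u2)).
rewrite /deviation -integralRD; last 2 first.
- exact: integrable_deviation.
- exact: integrable_deviation.
apply: integralR_le.
- apply: integrable_deviation => //; first exact: measurableU.
  by move=> x [/ED|/FD].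
- by apply: integrableRD; exact: integrable_deviation.
move=> x; rewrite -mulrDl ler_wpM2r ?sqr_ge0// !indicE in_setU.
by rewrite -natrD ler_nat; case: (_ \in E); case: (_ \in F).
Qed.

Lemma controlled0 a : controlled a set0.
Proof.
split => //; exists 0 => // u u2; rewrite mul0r /deviation.
rewrite (_ : \int[mu]_x _ = \int[mu]_x (cst 0 x : R)).
  by rewrite /Rintegral integral0.
by apply: eq_Rintegral => x _; rewrite indicE in_set0 mul0r.
Qed.

Lemma controlled_big a (I : Type) (s : seq I) (F : I -> set X) :
  (forall i, controlled a (F i)) -> controlled a (\big[setU/set0]_(i <- s) F i).
Proof.
move=> cF; elim/big_ind : _ => //; first exact: controlled0.
by move=> *; exact: controlledU.
Qed.

(** Among all constants, the mean value, here [0], minimizes the deviation. *)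
Lemma poincare_of_controlled a : (forall x y, k x y = k y x) ->
  controlled a D -> exists2 c, 0 < c & forall u, mean_zero mu D u ->
  c * \int[mu]_x (u x ^+ 2) <=
  \int[mu]_x (u x * nonlocal_laplacian mu D k u x).
Proof.
move=> ksym [_ _ [C C0 CD]]; exists (2 * C + 1)^-1 => [|u [u2 u0]].
  by rewrite invr_gt0; lra.
have := CD u u2; rewrite deviationE// (dirichlet_laplacian mD Dfin kk ksym u2).
have -> : moment1 D u = 0.
  rewrite -[RHS]u0; apply: eq_Rintegral => x _.
  by rewrite -(square_integrable_mul_indic x u2).
have -> : moment2 D u = \int[mu]_x (u x ^+ 2).
  apply: eq_Rintegral => x _.
  by rewrite {2}(square_integrable_mul_indic x u2) exprMn indic_sqr.
have := dirichlet_ge0 u; rewrite (dirichlet_laplacian mD Dfin kk ksym u2).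
set q := \int[mu]_x _; set U := \int[mu]_x _ => q0 h.
rewrite ler_pdivrMl; last by lra.
have : 0 <= a u ^+ 2 * mass D by rewrite mulr_ge0 ?sqr_ge0 ?mass_ge0.
lra.
Qed.

End poincare.

(** * Kernels and domains in Euclidean space *)

Section euclidean.
Context (R : realType) (N : nat).
Local Notation E := (Rn R N).
Local Notation mu := (@lebesgueN R N).

(** Balls with rational centres and radii [1 / n] form a countable basis, so an
    open subset of the product is a countable union of measurable rectangles. *)
Lemma open_prod_measurable_Rn (U : set (E * E)) : open U -> measurable U.
Proof.
move=> oU.
pose r (q : 'rV[rat]_N) : E := map_mx ratr q.
pose B (t : 'rV[rat]_N * 'rV[rat]_N * nat) : set (E * E) :=
  ball (r t.1.1) t.2.+1%:R^-1 `*` ball (r t.1.2) t.2.+1%:R^-1.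
have -> : U = \bigcup_t (if pselect (B t `<=` U) then B t else set0).
  apply/seteqP; split=> [p Up|p [t _]]; last by case: pselect => // BU /BU.
  have [e /= e0 eU] : exists2 e : R, 0 < e & ball p e `<=` U.
    by move/nbhs_ballP: (open_nbhs_nbhs (conj oU Up)) => [e]; exists e.
  pose n := Num.truncn (2 / e).
  have ne : n.+1%:R^-1 < e / 2 :> R.
    by rewrite -[ltRHS]invrK invf_div ltf_pV2 ?posrE ?divr_gt0// truncnS_gt.
  have n0 : 0 < n.+1%:R^-1 :> R by rewrite invr_gt0.
  have near (x y z : E) : ball x n.+1%:R^-1 y -> ball y n.+1%:R^-1 z -> ball x e z.
    move=> xy yz; apply: (@le_ball _ _ _ (n.+1%:R^-1 + n.+1%:R^-1)).
      by rewrite [e]splitr lerD ?ltW.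
    exact: ball_triangle xy yz.
  have [q1 b1] := rat_ball_rV p.1 n0; have [q2 b2] := rat_ball_rV p.2 n0.
  exists (q1, q2, n) => //; case: pselect => /= [_|].
    by split => /=; exact: ball_sym.
  by case=> y [/= y1 y2]; apply: eU; split; [exact: near b1 y1|exact: near b2 y2].
apply: countable_bigcupT_measurable => [|t]; first exact: countableP.
case: pselect => /= [BU|_]; last exact: measurable0.
by apply: measurableX; apply: open_measurable_Rn; exact: ball_open.
Qed.

Lemma continuous_measurable_kernel (V : E -> E -> R) :
  continuous (fun p : E * E => V p.1 p.2) ->
  measurable_fun [set: E * E] (fun p => V p.1 p.2).
Proof.
move=> cV; apply: (measurability _ (RGenOpens.measurableE R)).
move=> _ [_ [a [b ->] <-]]; rewrite setTI; apply: open_prod_measurable_Rn.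
by apply: open_comp => [p _|]; [exact: cV|exact: interval_open].
Qed.

Lemma compact_closure_bounded (D : set E) : bounded_set D -> compact (closure D).
Proof.
move=> [M [_ DM]]; have DM1 x : D x -> `|x| <= M + 1 by apply: DM; rewrite ltrDl.
apply: bounded_closed_compact; last exact: closed_closure.
exists (M + 1); split; first exact: num_real.
move=> M' MM' x; have : closure D `<=` [set x : E | `|x| <= M + 1].
  rewrite [X in _ `<=` X](closure_id _).1.
    by apply: closureS => y; exact: DM1.
  apply: (@closed_comp E R (fun x => `|x|) [set r | r <= M + 1]).
    by move=> y _; exact: norm_continuous.
  exact: closed_le.
by move=> /[apply] /= /le_trans; apply; exact: ltW.
Qed.

Lemma kernel_bounded_compact (V : E -> E -> R) (K : set E) :
  continuous (fun p : E * E => V p.1 p.2) -> compact K ->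
  exists M, forall x y, K x -> K y -> `|V x y| <= M.
Proof.
move=> cV cK; have cKK := compact_setX cK cK.
have := @continuous_compact _ _ (fun p : E * E => V p.1 p.2) (K `*` K).
move=> /(_ (continuous_subspaceT cV) cKK) /compact_bounded [M [_ VM]].
exists (M + 1) => x y Kx Ky; apply: (VM (M + 1)); first by rewrite ltrDl.
by exists (x, y).
Qed.

(** Continuity at [(x, x)] gives a lower bound near each [x]; compactness makes
    it uniform. One parameter [e] serves as radius and as lower bound. *)
Lemma kernel_lower_bound_compact (V : E -> E -> R) (K : set E) :
  continuous (fun p : E * E => V p.1 p.2) -> (forall x, 0 < V x x) ->
  compact K ->
  \forall e \near 0^'+, forall x y, K x -> ball x e y -> e <= V x y.
Proof.
move=> cV Vpos /compact_near_coveringP /(_ R 0^'+) H.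
apply: filterS (H (fun e x => forall y, ball x e y -> e <= V x y) _ _).
  by move=> e KP x y Kx; exact: KP.
move=> x Kx; have Vx := Vpos x.
have /nbhs_ballP[e /= e0 He] : \forall p \near (x, x), V x x / 2 < V p.1 p.2.
  have Vx2 : V x x / 2 < V x x by rewrite ltr_pdivrMr// ltr_pMr// ltr1n.
  exact: (cvgr_gt (V x x) (cV (x, x)) _ Vx2).
have e20 : 0 < e / 2 by rewrite divr_gt0.
exists (ball x (e / 2), [set t | t < Num.min (e / 2) (V x x / 2)]) => /=.
  split; first exact: nbhsx_ballx.
  by apply: nbhs_right_lt; rewrite lt_min e20 divr_gt0.
move=> [x' t] [/= xx' tm] y x'y.
have /andP[te tV] : (t < e / 2) && (t < V x x / 2) by rewrite -lt_min.
rewrite (le_trans (ltW tV))// ltW//; apply: (He (x', y)); split => /=.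
  by apply: le_ball xx'; rewrite ler_pdivrMr// ler_pMr// ler1n.
rewrite [e]splitr; apply: ball_triangle xx' _.
by apply: le_ball x'y; exact: ltW.
Qed.

(** The ball contains a box around its centre. *)
Lemma lebesgueN_ball_gt0 (x : E) (e : R) (D : set E) : open D -> D x -> 0 < e ->
  (0 < mu (ball x e `&` D))%E.
Proof.
move=> oD Dx e0.
have /nbhs_ballP[r /= r0 rD] := open_nbhs_nbhs (conj oD Dx).
pose m := Num.min e r / 2.
have m0 : 0 < m by rewrite divr_gt0// lt_min e0.
have ml : m < Num.min e r by rewrite /m ltr_pdivrMr// ltr_pMr ?ltr1n// lt_min e0.
pose c : E := const_mx m.
apply: (@lt_le_trans _ _ (mu (box_rV (x - c) (x + c)))).
  rewrite lebesgueN_box => [|i]; last by rewrite !mxE; lra.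
  rewrite lte_fin; apply: prodr_gt0 => i _; rewrite !mxE; lra.
apply: le_measure; rewrite ?inE.
- by apply: borel_measurable_Rn; exact: measurable_box.
- apply: measurableI; apply: open_measurable_Rn => //; exact: ball_open.
move=> y yb.
have ball_y s : Num.min e r <= s -> ball x s y.
  move=> ms; split; first by rewrite (lt_le_trans _ ms)// lt_min e0.
  move=> i j; rewrite ord1; have := yb j; rewrite in_itv/= !mxE => /andP[h1 h2].
  rewrite /ball /= (lt_le_trans _ ms)// (le_lt_trans _ ml)// ler_norml; lra.
split; first by apply: ball_y; rewrite ge_min lexx.
by apply/rD/ball_y; rewrite ge_min lexx orbT.
Qed.

Lemma lebesgueN_bounded (D : set E) : measurable D -> bounded_set D ->
  (mu D < +oo)%E.
Proof.
move=> mD [M [_ DM]].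
have DM1 x : D x -> ball (0 : E) (`|M| + 2) x.
  move=> Dx; rewrite -ball_normE /= sub0r normrN.
  have : `|x| <= `|M| + 1.
    by apply: DM Dx; rewrite (le_lt_trans (ler_norm M))// ltrDl.
  by move=> /le_lt_trans; apply; rewrite ltrD2l ltr1n.
pose c : E := const_mx (`|M| + 2).
apply: (@le_lt_trans _ _ (mu (box_rV (- c) c))); last first.
  rewrite lebesgueN_box ?ltry// => i; rewrite !mxE.
  by have := normr_ge0 M; lra.
apply: le_measure; rewrite ?inE//.
  by apply: borel_measurable_Rn; exact: measurable_box.
move=> x /DM1 [_ xM] i; rewrite in_itv /= !mxE -ler_norml ltW//.
by have := xM ord0 i; rewrite /ball /= mxE sub0r normrN.
Qed.

Lemma bounded_finite_cover (D : set E) (e : R) : bounded_set D -> 0 < e ->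
  exists s : seq E, (forall x, x \in s -> D x) /\
    D `<=` \big[setU/set0]_(x <- s) ball x e.
Proof.
move=> bD e0; have := compact_closure_bounded bD.
rewrite compact_cover => /(_ E D (fun x => ball x e)) [||s sD cs].
- by move=> x _; exact: ball_open.
- move=> y /(_ (ball y e) (nbhsx_ballx _ _ e0)) [x [Dx yx]].
  by exists x => //; exact: ball_sym.
exists (finmap.enum_fset s); split => [x /sD|x Dx]; first by rewrite inE.
by rewrite -bigcup_fset; apply: cs; exact: subset_closure.
Qed.

Lemma massE (D Q : set E) : measurable D -> (mu D < +oo)%E -> measurable Q ->
  Q `<=` D -> (mass mu Q)%:E = mu Q.
Proof.
move=> mD Dfin mQ QD; rewrite /mass EFin_integralR.
  by rewrite integral_indic// setIT.
exact: integrableR_indic Dfin _ mQ QD.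
Qed.

(** The set of points of [D] around which the deviation is controlled is open
    and closed in [D]: points of two balls of radius [e / 3] whose centres are
    at distance less than [e / 3] interact through a kernel bounded below
    by [e]. *)
Lemma poincare_domain (D : set E) (k : E -> E -> R) (e : R) :
  open D -> connected D -> bounded_set D -> bounded_kernel D k ->
  (forall x y, 0 <= k x y) -> (forall x y, k x y = k y x) -> 0 < e ->
  (forall x y, D x -> D y -> ball x e y -> e <= k x y) ->
  exists2 c, 0 < c & forall u, mean_zero mu D u ->
  c * \int[mu]_x (u x ^+ 2) <=
  \int[mu]_x (u x * nonlocal_laplacian mu D k u x).
Proof.
move=> oD cD bD kk k0 ksym e0 ke.
have mD : measurable D by exact: open_measurable_Rn.
have Dfin := lebesgueN_bounded mD bD.
suff [a ca] : exists a, controlled mu D k a D by exact: poincare_of_controlled ca.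
have [D0|/set0P[x0 Dx0]] := eqVneq D set0.
  by exists (fun=> 0); rewrite {2}D0; exact: controlled0.
pose r := e / 3.
have r0 : 0 < r by rewrite divr_gt0.
pose Q x : set E := ball x r `&` D.
have mQ x : measurable (Q x).
  by apply: measurableI => //; apply: open_measurable_Rn; exact: ball_open.
have QD x : Q x `<=` D by move=> y [].
have Q0 x : D x -> 0 < mass mu (Q x).
  by move=> Dx; rewrite -lte_fin (massE mD Dfin)// lebesgueN_ball_gt0.
have kQ x x' : ball x r x' -> forall y y', Q x y -> Q x' y' -> e <= k y y'.
  move=> xx' y y' [xy Dy] [xy' Dy']; apply: ke => //.
  rewrite (_ : e = r + r + r); last by rewrite /r; field.
  apply: ball_triangle xy'; apply: ball_triangle xx'; exact: ball_sym.
pose a u := moment1 mu (Q x0) u / mass mu (Q x0).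
exists a; pose S x := controlled mu D k a (Q x).
have S0 : S x0.
  by apply: (controlled_start mD Dfin kk) e0 _ => //; [exact: Q0|exact/kQ/ballxx].
have step x x' : D x -> ball x r x' -> S x -> S x'.
  move=> Dx xx' Sx.
  apply: (controlled_step mD Dfin kk) Sx _ _ _ e0 (kQ _ _ xx') => //.
  exact: Q0.
have SD : D `&` S = D.
  apply: cD.
  - by exists x0.
  - exists (\bigcup_(x in D `&` S) ball x r).
      by apply: bigcup_open => x _; exact: ball_open.
    apply/seteqP; split => [x [Dx Sx]|x [Dx [y [Dy Sy] yx]]].
      by split => //; exists x => //; exact: ballxx.
    by split; [exact: Dx|exact: (step _ _ Dy yx Sy)].
  - exists (~` \bigcup_(x in D `&` ~` S) ball x r).
      by apply: open_closedC; apply: bigcup_open => x _; exact: ball_open.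
    apply/seteqP; split => [x [Dx Sx]|x [Dx nS]].
      split; first exact: Dx.
      by case=> y [Dy Sy] yx; apply: Sy; exact: (step _ _ Dx (ball_sym yx) Sx).
    split; first exact: Dx.
    by apply: contrapT => Sx; apply: nS; exists x; [split|exact: ballxx].
have [s [sD Ds]] := bounded_finite_cover bD r0.
have DE : D = \big[setU/set0]_(x <- s) (if pselect (D x) then Q x else set0).
  apply/seteqP; split => x.
    move=> Dx; have := Ds x Dx; rewrite -!bigcup_seq => -[y /= ys yx].
    by exists y => //; case: pselect => //; have := sD y ys.
  by rewrite -bigcup_seq => -[y _]; case: pselect => // _ [].
have cF x : controlled mu D k a (if pselect (D x) then Q x else set0).
  case: (pselect (D x)) => [Dx|_] /=; last exact: controlled0.
  by move: Dx; rewrite -{1}SD => -[].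
rewrite {2}DE; exact: controlled_big.
Qed.

End euclidean.

(** * The two-phase kernel *)

Section block_kernels.
Context (R : realType) (N : nat).
Local Notation E := (Rn R N).
Local Notation mu := [the {sigma_finite_measure set E -> \bar R} of @lebesgueN R N].
Variable D : set E.
Hypotheses (mD : measurable D) (bD : bounded_set D).
Implicit Types (P Q : set E) (V : E -> E -> R) (u v : E -> R).

Let Dfin : (mu D < +oo)%E. Proof. exact: lebesgueN_bounded. Qed.

Definition block P Q V x y : R := \1_P x * \1_Q y * V x y.

Lemma bounded_kernel_block P Q V : measurable P -> measurable Q ->
  P `<=` D -> Q `<=` D -> continuous (fun p : E * E => V p.1 p.2) ->
  bounded_kernel D (block P Q V).
Proof.
move=> mP mQ PD QD cV; have bPQ := bounded_kernel_indic R mP mQ PD QD.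
split.
  exact: measurable_funM bPQ.1 (continuous_measurable_kernel cV).
have [M VM] := kernel_bounded_compact cV (compact_closure_bounded bD).
exists `|M| => x y; rewrite /block normrM [`|\1_P x * _|]ger0_norm ?mulr_ge0// mulrC.
have [Px|Px] := pselect (P x); last first.
  by rewrite [\1_P x]indicE memNset// mul0r mulr0 !mulr_ge0.
have [Qy|Qy] := pselect (Q y); last first.
  by rewrite [\1_Q y]indicE memNset// !mulr0 !mulr_ge0.
rewrite !indicE !mem_set//; [|exact: QD|exact: PD]; rewrite !mulr1.
rewrite (le_trans (VM x y _ _)) ?ler_norm//; apply: subset_closure.
  exact: PD.
exact: QD.
Qed.

Lemma block_tr P Q V : (forall x y, V x y = V y x) ->
  block Q P V = fun x y => block P Q V y x.
Proof.
move=> Vsym; apply/funext => x; apply/funext => y.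
by rewrite /block Vsym [\1_Q x * _]mulrC.
Qed.

Lemma integral_block P Q V (h : E -> R) x :
  \int[mu]_y (block P Q V x y * h y) = \1_P x * \int[mu]_(y in Q) (V x y * h y).
Proof.
rewrite [in RHS]Rintegral_mkcond /block indicE.
case: (x \in P); last first.
  rewrite mul0r; transitivity (\int[mu]_y (cst 0 y : R)).
    by apply: eq_Rintegral => y _; rewrite !mul0r.
  by rewrite /Rintegral integral0.
rewrite mul1r; apply: eq_Rintegral => y _.
by rewrite patchE mul1r indicE; case: (y \in Q); rewrite ?mul1r ?mul0r.
Qed.

Lemma dirichlet_block P Q V u : P `<=` D -> Q `<=` D ->
  dirichlet mu (block P Q V) (u \_ D) =
  \int[@lebesgueN R N]_(x in P) \int[@lebesgueN R N]_(y in Q)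
    (V x y * (u y - u x) ^+ 2).
Proof.
move=> PD QD; rewrite [in RHS]Rintegral_mkcond; apply: eq_Rintegral => x _.
rewrite integral_block indicE [RHS]patchE.
case: (boolP (x \in P)) => [/set_mem Px|_]; last by rewrite mul0r.
rewrite mul1r; apply: eq_Rintegral => y /set_mem Qy.
by rewrite !patchE !mem_set//; [exact: PD|exact: QD].
Qed.

Lemma mean_zero_of_W u : W D u -> mean_zero mu D (u \_ D).
Proof.
move=> [uL u0]; split; last by rewrite -Rintegral_mkcond.
split.
- by move: uL; rewrite inE => /andP[]; rewrite inE.
- exact: Lfun2_integrable_sqr.
- by move=> x Dx; rewrite patchE memNset.
Qed.

Lemma restrict_square_integrable u : square_integrable mu D u -> u \_ D = u.
Proof.
move=> [_ _ u0]; apply/funext => x; rewrite patchE.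
case: (boolP (x \in D)) => // /negP xD; rewrite u0// => Dx.
by apply: xD; rewrite inE.
Qed.

Lemma W_of_mean_zero u : mean_zero mu D u -> W D u.
Proof.
move=> [u2 u0]; split; last by rewrite Rintegral_mkcond restrict_square_integrable.
rewrite restrict_square_integrable//; case: u2 => mu_ iu _.
rewrite inE; apply/andP; split; rewrite inE//= /finite_norm unlock /=.
apply: poweR_lty; move/integrableP : iu => [_]; apply: le_lt_trans.
rewrite le_eqVlt; apply/orP; left; apply/eqP; apply: eq_integral => x _ /=.
by rewrite powR_mulrn// normrX.
Qed.

Section two_phases.
Variables (A B : set E) (J G K : E -> E -> R).
Hypotheses (mA : measurable A) (mB : measurable B).
Hypotheses (DE : D = A `|` B) (AB0 : A `&` B = set0).
Hypotheses (kJ : admissible_kernel J) (kG : admissible_kernel G).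
Hypothesis kK : admissible_kernel K.

Definition two_phase_kernel x y : R :=
  block A A J x y + block B B G x y + (block A B K x y + block B A K x y).
Local Notation k := two_phase_kernel.

Let AD : A `<=` D. Proof. by rewrite DE => x; left. Qed.
Let BD : B `<=` D. Proof. by rewrite DE => x; right. Qed.

Let bAA : bounded_kernel D (block A A J).
Proof. by case: kJ => cJ *; exact: bounded_kernel_block. Qed.
Let bBB : bounded_kernel D (block B B G).
Proof. by case: kG => cG *; exact: bounded_kernel_block. Qed.
Let bAB : bounded_kernel D (block A B K).
Proof. by case: kK => cK *; exact: bounded_kernel_block. Qed.
Let bBA : bounded_kernel D (block B A K).
Proof. by case: kK => cK *; exact: bounded_kernel_block. Qed.

Lemma bounded_two_phase_kernel : bounded_kernel D k.
Proof. by apply: bounded_kernelD; apply: bounded_kernelD. Qed.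

Lemma two_phase_kernel_sym x y : k x y = k y x.
Proof.
case: kJ kG kK => _ _ _ Js _ [_ _ _ Gs _] [_ _ _ Ks _].
by rewrite /two_phase_kernel /block (Js y x) (Gs y x) (Ks y x); ring.
Qed.

Lemma two_phase_kernel_ge0 x y : 0 <= k x y.
Proof.
case: kJ kG kK => _ J0 _ _ _ [_ G0 _ _ _] [_ K0 _ _ _].
by rewrite !addr_ge0// !mulr_ge0.
Qed.

(** Near the interface between [A] and [B] it is the mixed kernel that connects
    the two phases, so its positivity on the diagonal is essential. *)
Lemma two_phase_kernel_lower_bound : exists2 e, 0 < e &
  forall x y, D x -> D y -> ball x e y -> e <= k x y.
Proof.
case: kJ kG kK => cJ _ Jp _ _ [cG _ Gp _ _] [cK _ Kp _ _].
have cD := compact_closure_bounded bD.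
have nJ := kernel_lower_bound_compact cJ Jp cD.
have nG := kernel_lower_bound_compact cG Gp cD.
have nK := kernel_lower_bound_compact cK Kp cD.
have [e [e0 [eJ [eG eK]]]] : exists e : R, 0 < e /\
  ((forall x y, closure D x -> ball x e y -> e <= J x y) /\
   (forall x y, closure D x -> ball x e y -> e <= G x y) /\
   (forall x y, closure D x -> ball x e y -> e <= K x y)).
  near (0 : R)^'+ => e; exists e; split; first by near: e; exact: nbhs_right_gt.
  by split; [near: e|split; near: e].
exists e => // x y Dx Dy xy; have cx := subset_closure Dx.
have AnB z : A z -> (z \in B) = false.
  move=> Az; apply/negbTE/negP => /set_mem Bz.
  by have : (A `&` B) z by []; rewrite AB0.
have BnA z : B z -> (z \in A) = false.
  move=> Bz; apply/negbTE/negP => /set_mem Az.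
  by have : (A `&` B) z by []; rewrite AB0.
move: Dx Dy; rewrite DE /two_phase_kernel /block !indicE => -[Ax|Bx] [Ay|By].
- rewrite (mem_set Ax) (mem_set Ay) (AnB x)// (AnB y)//.
  by rewrite !(mul0r, mulr0, mul1r, addr0, add0r) eJ.
- rewrite (mem_set Ax) (mem_set By) (AnB x)// (BnA y)//.
  by rewrite !(mul0r, mulr0, mul1r, addr0, add0r) eK.
- rewrite (mem_set Bx) (mem_set Ay) (BnA x)// (AnB y)//.
  by rewrite !(mul0r, mulr0, mul1r, addr0, add0r) eK.
- rewrite (mem_set Bx) (mem_set By) (BnA x)// (BnA y)//.
  by rewrite !(mul0r, mulr0, mul1r, addr0, add0r) eG.
Unshelve. all: by end_near.
Qed.

Lemma nonlocal_opE u x : square_integrable mu D (u \_ D) -> D x ->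
  nonlocal_op J G K A B u x = - nonlocal_laplacian mu D k (u \_ D) x.
Proof.
move=> u2 Dx; set v := u \_ D in u2 *.
have i l : bounded_kernel D l -> integrableR mu (fun y => l x y * (v y - v x)).
  by move=> bl; exact: (integrable_kernel_increment mD Dfin x bl u2).
rewrite (laplacianE mD Dfin x bounded_two_phase_kernel u2) opprK.
transitivity (\int[mu]_y ((block A A J x y * (v y - v x) +
   block B B G x y * (v y - v x)) + (block A B K x y * (v y - v x) +
   block B A K x y * (v y - v x)))); last first.
  by apply: eq_Rintegral => y _; rewrite /two_phase_kernel !mulrDl.
rewrite integralRD; last 2 first.
- by apply: integrableRD; exact: i.
- by apply: integrableRD; exact: i.
rewrite !integralRD; [|exact: i..].
rewrite !integral_block /nonlocal_op.
have vE V Q : Q `<=` D -> \int[mu]_(y in Q) (V x y * (u y - u x)) =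
    \int[mu]_(y in Q) (V x y * (v y - v x)).
  move=> QD; apply: eq_Rintegral => y /set_mem/QD Dy.
  by rewrite /v !patchE !mem_set.
rewrite !vE//; ring.
Qed.

(** The mixed term of the energy appears once and with weight [1/2], whereas the
    Dirichlet form of the glued kernel contains both mixed blocks; these have the
    same form because they are transposes of each other. *)
Lemma energyE f v : square_integrable mu D (v \_ D) ->
  energy J G K D A B f v = laplacian_energy mu D k (f \_ D) (v \_ D).
Proof.
move=> v2; case: (kK) => _ _ _ Ks _.
have kk := bounded_two_phase_kernel.
have dk := dirichlet_laplacian mD Dfin kk two_phase_kernel_sym v2.
rewrite /laplacian_energy.
have -> : \int[mu]_x ((v \_ D) x * nonlocal_laplacian mu D k (v \_ D) x) =
  2^-1 * dirichlet mu k (v \_ D) by rewrite dk; field.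
have -> : dirichlet mu k (v \_ D) = dirichlet mu (block A A J) (v \_ D) +
   dirichlet mu (block B B G) (v \_ D) + 2 * dirichlet mu (block A B K) (v \_ D).
  have eBA : dirichlet mu (block B A K) (v \_ D) =
      dirichlet mu (block A B K) (v \_ D).
    by rewrite (block_tr A B Ks); exact: (dirichlet_tr mD Dfin bAB v2).
  have bD1 := bounded_kernelD bAA bBB; have bD2 := bounded_kernelD bAB bBA.
  rewrite (dirichletD mD Dfin bD1 bD2 v2).
  rewrite (dirichletD mD Dfin bAA bBB v2) (dirichletD mD Dfin bAB bBA v2) eBA.
  by rewrite [2 * _]mulr_natl mulr2n.
have -> : \int[mu]_x ((f \_ D) x * (v \_ D) x) =
    \int[@lebesgueN R N]_(x in D) (f x * v x).
  rewrite [RHS]Rintegral_mkcond; apply: eq_Rintegral => x _.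
  by rewrite !patchE; case: (x \in D); rewrite ?mul0r.
rewrite /energy -(dirichlet_block J v AD AD) -(dirichlet_block G v BD BD).
rewrite -(dirichlet_block K v AD BD).
move: (dirichlet mu (block A A J) _) (dirichlet mu (block B B G) _) => a b.
move: (dirichlet mu (block A B K) _) (\int[_]_(x in D) _) => a' b'.
by field.
Qed.

End two_phases.
End block_kernels.

(** * The variational characterization of the solution *)

Theorem theorem4p1 (R : realType) (N : nat) (Omega : set (Rn R N))
  (openOmega : open Omega) (connectedOmega : connected Omega)
  (boundedOmega : bounded_set Omega)
  (J G K : Rn R N -> Rn R N -> R)
  (kernelJ : admissible_kernel J) (kernelG : admissible_kernel G)
  (kernelK : admissible_kernel K)
  (A B : nat -> set (Rn R N))
  (AB : forall n, (1 <= n)%N ->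
    [/\ measurable (A n), measurable (B n),
        Omega = A n `|` B n & A n `&` B n = set0])
  (n : nat) (n1 : (1 <= n)%N)
  (f : Rn R N -> R) (Wf : W Omega f) :
  let mu := @lebesgueN R N in
  let E := energy J G K Omega (A n) (B n) f in
  let solution u := ae_eq mu Omega f (nonlocal_op J G K (A n) (B n) u) in
  exists u : Rn R N -> R,
    [/\ W Omega u,
        solution u,
        (forall w, W Omega w -> solution w -> ae_eq mu Omega w u),
        (forall v, W Omega v -> E u <= E v) &
        (forall w, W Omega w -> (forall v, W Omega v -> E w <= E v) ->
          ae_eq mu Omega w u)].
Proof.
move=> mu E solution; have [mA mB DE AB0] := AB n n1.
have mD : measurable Omega by exact: open_measurable_Rn.
have Dfin := lebesgueN_bounded mD boundedOmega.
pose k := two_phase_kernel (A n) (B n) J G K.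
have kk : bounded_kernel Omega k.
  exact: bounded_two_phase_kernel.
have ksym := two_phase_kernel_sym (A n) (B n) kernelJ kernelG kernelK.
have k0 := two_phase_kernel_ge0 (A n) (B n) kernelJ kernelG kernelK.
have [e e0 ke] :=
  two_phase_kernel_lower_bound boundedOmega DE AB0 kernelJ kernelG kernelK.
have [c c0 coercive] :=
  poincare_domain openOmega connectedOmega boundedOmega kk k0 ksym e0 ke.
have [u zu [luf uniq minu uniq_min]] :=
  coercive_minimizer mD Dfin kk ksym c0 coercive (mean_zero_of_W Wf).
have ur : u \_ Omega = u by case: zu => u2 _; exact: restrict_square_integrable.
have Wu : W Omega u by exact: W_of_mean_zero.
have EE v : W Omega v ->
    E v = laplacian_energy mu Omega k (f \_ Omega) (v \_ Omega).
  by move=> /mean_zero_of_W[v2 _]; exact: energyE.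
have opE v x : W Omega v -> Omega x -> nonlocal_op J G K (A n) (B n) v x =
    - nonlocal_laplacian mu Omega k (v \_ Omega) x.
  by move=> /mean_zero_of_W[v2 _] Ox; exact: nonlocal_opE.
have ae_restrict w : ae_eq mu [set: Rn R N] (w \_ Omega) u -> ae_eq mu Omega w u.
  by apply: filterS => x H Ox; rewrite -H// patchE mem_set.
exists u; split; first exact: Wu.
- apply: filterS luf => x H Ox.
  by rewrite opE// ur H// opprK patchE mem_set.
- move=> w Ww sw; apply/ae_restrict/uniq; first exact: mean_zero_of_W.
  apply: filterS sw => x H _; have [Ox|Ox] := pselect (Omega x).
    by rewrite patchE mem_set// H// opE// opprK.
  have [w2 _] := mean_zero_of_W Ww.
  have [_ _ ->//] := square_integrable_laplacian mD Dfin kk w2.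
  by rewrite patchE memNset// oppr0.
- move=> v Wv; rewrite !EE// ur; apply: minu; exact: mean_zero_of_W.
- move=> w Ww mw; apply/ae_restrict/uniq_min; first exact: mean_zero_of_W.
  by have := mw u Wu; rewrite !EE// ur.
Qed.
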